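(* Let $n$ be a positive integer with $n \notin \{1,2,3,4,6,8,12,20\}$. Let $$d = \begin{cases}\varphi(n) & \text{if } \gcd(n,8) < 4,\\ \varphi(n)/4 & \text{if } \gcd(n,8) = 4 \text{ and } n \ne 4,\\ \varphi(n)/2 & \text{if } \gcd(n,8) > 4,\end{cases}$$ so that $\deg \Pi_n = d$ and $d \ge 3$. 1. If $n \equiv 4 \pmod 8$ and $d \ge 5$ is odd, then $\operatorname{Aut}\Pi_n = \{I\} \cong \mathbf{C}_1$ and $\operatorname{Aut}|\Pi_n| = \{\pm I\} \cong \mathbf{C}_2$. 2. If $n \equiv 4 \pmod 8$ and $d \ge 6$ is even, then $\operatorname{Aut}\Pi_n = \operatorname{Aut}|\Pi_n| = \{\pm I\} \cong \mathbf{C}_2$. 3. If $n \not\equiv 4 \pmod 8$ and $n \ne 24$, then $$\operatorname{Aut}\Pi_n = \left\langle \begin{pmatrix}-1&0\\0&1\end{pmatrix}, \begin{pmatrix}1&0\\0&-1\end{pmatrix}\right\rangle \cong \mathbf{D}_2.$$ 4. If $n \in \{24,28,36,60\}$, then: (a) for $n \in \{28,36\}$: $\operatorname{Aut}\Pi_n = \left\langle \begin{pmatrix}-1&1\\-1&0\end{pmatrix}\right\rangle$, which is $\operatorname{GL}_2(\mathbb{Q})$-conjugate to $\mathbf{C}_3$, and $\operatorname{Aut}|\Pi_n| = \left\langle \begin{pmatrix}-1&1\\-1&0\end{pmatrix}, \begin{pmatrix}-1&0\\0&-1\end{pmatrix}\right\rangle$, which is $\operatorname{GL}_2(\mathbb{Q})$-conjugate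 to $\mathbf{D}_3$; (b) for $n = 60$: $\operatorname{Aut}\Pi_{60} = \operatorname{Aut}|\Pi_{60}| = \left\langle \begin{pmatrix}1&2\\-1&-1\end{pmatrix}\right\rangle$, which is $\operatorname{GL}_2(\mathbb{Q})$-conjugate to $\mathbf{C}_4$; (c) for $n = 24$: $\operatorname{Aut}\Pi_{24} = \operatorname{Aut}|\Pi_{24}| = \left\langle \begin{pmatrix}0&1\\1&0\end{pmatrix}, \begin{pmatrix}0&1\\-1&0\end{pmatrix}\right\rangle = \mathbf{D}_4$.
   Context: $\varphi$ is Euler's totient function and $I$ is the $2\times 2$ identity matrix. $\Pi_n(x)$ denotes the minimal polynomial over $\mathbb{Q}$ of $2\sin(2\pi/n)$, and $\Pi_n(x,y)$ (also written $\Pi_n$) is its homogenization. For a binary form $F(x,y)$ and a matrix $M = \begin{pmatrix}s&u\\t&v\end{pmatrix}$ put $F_M(x,y) = F(sx+uy,\, tx+vy)$. $\operatorname{Aut} F$ is the group of all $2\times2$ matrices $M$ with rational entries such that $F_M = F$, and $\operatorname{Aut}|F|$ is the group of all $2\times 2$ matrices $M$ with rational entries such that $F_M = F$ or $F_M = -F$. The following finite subgroups of $\operatorname{GL}_2(\mathbb{Q})$ are fixed: $\mathbf{C}_1 = \{I\}$, $\mathbf{C}_2 = \{\pm I\}$, $\mathbf{C}_3 = \left\langle\begin{pmatrix}0&1\\-1&-1\end{pmatrix}\right\rangle$, $\mathbf{C}_4 = \left\langle\begin{pmatrix}0&1\\-1&0\end{pmatrix}\right\rangle$, $\mathbf{D}_2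 = \left\langle\begin{pmatrix}0&1\\1&0\end{pmatrix}, \begin{pmatrix}-1&0\\0&-1\end{pmatrix}\right\rangle$, $\mathbf{D}_3 = \left\langle\begin{pmatrix}0&1\\1&0\end{pmatrix}, \begin{pmatrix}0&1\\-1&-1\end{pmatrix}\right\rangle$, $\mathbf{D}_4 = \left\langle\begin{pmatrix}0&1\\1&0\end{pmatrix}, \begin{pmatrix}0&1\\-1&0\end{pmatrix}\right\rangle$.
   Formalization: In 4(a), Aut|Π_n| for n = 28, 36 is stated to be conjugate to the cyclic group C_6 = ⟨(0 1; -1 1)⟩ instead of D_3, since the displayed group ⟨(-1 1; -1 0), -I⟩ is abelian of order 6 while D_3 is nonabelian. *)

(* Defs.v *)
From HB Require Import structures.
From mathcomp Require Import all_boot all_order all_algebra.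
From mathcomp Require Import all_classical all_reals all_analysis.
(* The notations of mpoly clash with those of mathcomp-analysis. *)
From mathcomp Require Import -(notations) mpoly.

Set Implicit Arguments.
Unset Strict Implicit.
Unset Printing Implicit Defensive.

Import Order.TTheory GRing.Theory Num.Theory.
Local Open Scope classical_set_scope.
Local Open Scope ring_scope.

Definition is_minpolyQ (R : realType) (a : R) (p : {poly rat}) : Prop :=
  [/\ p \is monic, root (map_poly ratr p) a &
      forall q : {poly rat}, q != 0 -> root (map_poly ratr q) a ->
        (size p <= size q)%N].

(* Equal to 0 when [a] is transcendental. *)
Definition minpolyQ (R : realType) (a : R) : {poly rat} :=
  xget 0 [set p | is_minpolyQ a p].

Definition bform : Type := mpoly 2 rat.

(* Xvar 0 is x and Xvar 1 is y. *)
Definition Xvar (i : 'I_2) : bform := mpolyX rat (mnm1 i).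

Definition homogenization (p : {poly rat}) : bform :=
  \sum_(i < size p)
    p`_i *: (Xvar 0 ^+ i * Xvar 1 ^+ ((size p).-1 - i)).

(* F_M (x, y) = F (s x + u y, t x + v y) for M = (s u // t v). *)
Definition subst_form (F : bform) (M : 'M[rat]_2) : bform :=
  comp_mpoly [tuple \sum_(j < 2) M i j *: Xvar j | i < 2] F.

Definition Aut (F : bform) : set 'M[rat]_2 :=
  [set M | subst_form F M = F].

Definition AutAbs (F : bform) : set 'M[rat]_2 :=
  [set M | subst_form F M = F \/ subst_form F M = - F].

(* Pi_n(x) and its homogenization Pi_n(x, y). *)
Definition sin_minpoly (R : realType) (n : nat) : {poly rat} :=
  minpolyQ (2 * sin (2 * pi / n%:R) : R).

Definition sin_form (R : realType) (n : nat) : bform :=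
  homogenization (sin_minpoly R n).

(* deg Pi_n; the value at n = 4 is irrelevant. *)
Definition sin_degree (n : nat) : nat :=
  if (gcdn n 8 < 4)%N then totient n
  else if gcdn n 8 == 4%N then (totient n %/ 4)%N
  else (totient n %/ 2)%N.

(* The matrix with rows (s, u) and (t, v). *)
Definition mx2 (s u t v : rat) : 'M[rat]_2 :=
  \matrix_(i, j) if i == 0 then (if j == 0 then s else u)
                 else (if j == 0 then t else v).

Definition is_subgroup (G : set 'M[rat]_2) : Prop :=
  [/\ G `<=` [set A | A \in unitmx], G 1%:M,
      forall A B, G A -> G B -> G (A *m B) &
      forall A, G A -> G (invmx A)].

(* The subgroup of GL_2(Q) generated by S; meaningful when S consists of
   invertible matrices, and equal to setT otherwise. *)
Definition generated (S : set 'M[rat]_2) : set 'M[rat]_2 :=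
  smallest is_subgroup S.

Definition isomorphic (G H : set 'M[rat]_2) : Prop :=
  exists2 f : 'M[rat]_2 -> 'M[rat]_2, set_bij G H f &
    forall A B, G A -> G B -> f (A *m B) = f A *m f B.

Definition conjugate (G H : set 'M[rat]_2) : Prop :=
  exists2 P : 'M[rat]_2, P \in unitmx &
    G = [set P *m A *m invmx P | A in H].

Definition C1 : set 'M[rat]_2 := [set 1%:M].
Definition C2 : set 'M[rat]_2 := [set 1%:M; - 1%:M].
Definition C3 : set 'M[rat]_2 := generated [set mx2 0 1 (-1) (-1)].
Definition C4 : set 'M[rat]_2 := generated [set mx2 0 1 (-1) 0].
Definition C6 : set 'M[rat]_2 := generated [set mx2 0 1 (-1) 1].
Definition D2 : set 'M[rat]_2 :=
  generated [set mx2 0 1 1 0; mx2 (-1) 0 0 (-1)].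
Definition D3 : set 'M[rat]_2 :=
  generated [set mx2 0 1 1 0; mx2 0 1 (-1) (-1)].
Definition D4 : set 'M[rat]_2 :=
  generated [set mx2 0 1 1 0; mx2 0 1 (-1) 0].

Lemma sub_generated (S : set 'M[rat]_2) : S `<=` generated S.
Proof. by move=> A SA G [_]; apply. Qed.

Lemma generated_min (S G : set 'M[rat]_2) :
  is_subgroup G -> S `<=` G -> generated S `<=` G.
Proof. by move=> sG SG A; apply. Qed.

Lemma centralizer_subgroup (A : 'M[rat]_2) :
  is_subgroup [set B | B \in unitmx /\ A *m B = B *m A].
Proof.
split=> [B []|||] //=.
- by rewrite unitmx1 mulmx1 mul1mx.
- move=> B C [uB cB] [uC cC]; split; first by rewrite unitmx_mul uB.
  by rewrite mulmxA cB -mulmxA cC mulmxA.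
- move=> B [uB cB]; split; first by rewrite unitmx_inv.
  apply: (can_inj (mulKmx uB)).
  by rewrite mulKVmx // mulmxA -cB mulmxK.
Qed.

(* [set M; -1] with M of order 3 generates a cyclic group of order 6, which is
   C6 and not the nonabelian group D3 of the same order. *)
Lemma not_conjugate_D3 :
  ~ conjugate (generated [set mx2 (-1) 1 (-1) 0; mx2 (-1) 0 0 (-1)]) D3.
Proof.
set S := [set _; _]; case=> P uP defG.
have mx2M s u t v s' u' t' v' : mx2 s u t v *m mx2 s' u' t' v' =
    mx2 (s * s' + u * t') (s * u' + u * v')
        (t * s' + v * t') (t * u' + v * v').
  apply/matrixP=> i j; rewrite !mxE big_ord_recl big_ord1 !mxE /=.
  by case: (i == 0); case: (j == 0).
have mx2_1 : mx2 1 0 0 1 = 1%:M.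
  by apply/matrixP=> -[[|[|//]] ?] [[|[|//]] ?]; rewrite !mxE.
have inv1 : mx2 (-1) 1 (-1) 0 *m mx2 0 (-1) 1 (-1) = 1%:M.
  by rewrite mx2M -mx2_1; congr mx2.
have inv2 : mx2 (-1) 0 0 (-1) *m mx2 (-1) 0 0 (-1) = 1%:M.
  by rewrite mx2M -mx2_1; congr mx2.
have uS A : S A -> A \in unitmx.
  by case=> ->; [have [] := mulmx1_unit inv1|have [] := mulmx1_unit inv2].
have cSS A B : S A -> S B -> A *m B = B *m A.
  by case=> -> [] ->; rewrite !mx2M; congr mx2.
have cGS A B : S A -> generated S B -> A *m B = B *m A.
  move=> SA /(generated_min (centralizer_subgroup A)) [C SC|//].
  by split; [apply: uS|apply: cSS].
have cGG A B : generated S A -> generated S B -> A *m B = B *m A.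
  move=> GA /(generated_min (centralizer_subgroup A)) [C SC|//].
  by split; [apply: uS|rewrite (cGS C A)].
have cD A B : D3 A -> D3 B -> A *m B = B *m A.
  move=> DA DB.
  have GD C : D3 C -> generated S (P *m C *m invmx P).
    by move=> DC; rewrite defG; exists C.
  have := cGG _ _ (GD _ DA) (GD _ DB).
  rewrite !mulmxA !mulmxKV // => /(can_inj (mulmxK _)).
  by rewrite unitmx_inv -!mulmxA => /(_ uP) /(can_inj (mulKmx uP)).
have := cD _ _ (sub_generated (or_introl erefl))
               (sub_generated (or_intror erefl)).
by rewrite !mx2M => /matrixP /(_ 0 0); rewrite !mxE.
Qed.

(* Main.v *)
Require Import Defs.
From HB Require Import structures.
From mathcomp Require Import all_boot all_order all_algebra all_field.
From mathcomp Require Import ring lra zify.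
From mathcomp Require Import complex.
From mathcomp Require Import all_classical all_reals all_analysis.
From mathcomp Require Import -(notations) mpoly.

Set Implicit Arguments.
Unset Strict Implicit.
Unset Printing Implicit Defensive.

Import Order.TTheory GRing.Theory Num.Theory.
Local Open Scope classical_set_scope.
Local Open Scope ring_scope.

(** Write t = 2 sin(2 pi/n) as w + 1/w with w a primitive N-th root of unity. Here
    4 divides N unless n = 4 mod 8, in which case n = 4 m with m odd and N is m or
    2 m. The conjugates of t are the numbers w^k + w^-k with k prime to N, and the
    question is how homographies with rational coefficients can relate them.
    Indeed a rational matrix that preserves, perhaps only up to sign, the form of
    the minimal polynomial p of t sends t to a root of p (AutAbs_moebius), which
    gives a relation
<<
      (c t + d) (w^k + w^-k) = a t + b
>>
    between at most nine powers of w. Such relations are very restricted.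

    If 4 divides N (four_moebius), the automorphism w -> - w splits the relation into
    c t t' = b and d t' = a t. The first one would make a product of two conjugate
    cosines rational, which occurs only for N = 4, 8, 12, 24. Hence the matrix is
    diagonal, and comparing leading and constant coefficients its entries are 1
    or -1.

    Otherwise one may assume, replacing w by - w if N = 2 m, that the order is the odd
    number m (odd_moebius). The powers of w are sorted by residue of the exponents
    modulo a prime p dividing m. Conjugating by the automorphisms that
    multiply w by p-th roots of unity shows that all the residue classes have the same
    sum, and that this sum is 0 when p^2 divides m (class_sum_sq, class_sum_simple).
    With more classes than exponents, or with a class of one exponent, the
    coefficients must vanish unless the relation is the trivial one. This works
    as soon as m is not a divisor of 15, 7 or 9, and leaves only scalar matrices.

    The degree of t and its conjugates are found in algC (cosz_minpoly): the
    polynomial p(x + 1/x) x^deg(p) is divisible by Phi_N, and averaging Phi_N over w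
    and 1/w shows that p has degree at most half that of Phi_N. The link with the
    real sine is the irreducibility of Phi_N (cosz_root_transfer).

    For n = 24, 28, 36 and 60 the polynomial is written down explicitly. Its roots
    are given by rational functions of t, and since t has degree 3 or 4, a matrix is
    determined up to a scalar factor by the root to which it sends t. *)

(** * Linear relations between roots of unity modulo a prime *)

Lemma sum_expr_unity_root (p : nat) (y : algC) :
  y ^+ p = 1 -> \sum_(t < p) y ^+ t = if y == 1 then p%:R else 0.
Proof.
move=> yp; case: eqP => [->|/eqP y1].
  by under eq_bigr do rewrite expr1n; rewrite sumr_const card_ord.
by apply: (mulfI (x := y - 1)); rewrite ?subr_eq0 // -subrX1 yp subrr mulr0.
Qed.

Lemma exprz_prim_root_eq1 (p : nat) (z : algC) (e : int) :
  prime p -> p.-primitive_root z -> (z ^ e == 1) = (e%:~R == 0 :> 'F_p).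
Proof.
move=> p_pr zp; have natE (m : nat) : (z ^+ m == 1) = (m%:R == 0 :> 'F_p).
  by rewrite -(prim_order_dvd zp) (dvdn_pcharf (pchar_Fp p_pr)).
case: e => m; first exact: natE.
by rewrite NegzE rmorphN /= oppr_eq0 -exprnN invr_eq1 natE.
Qed.

(** A relation between powers of x is encoded by the list E of its coefficients
    and exponents; this is the part of it with exponents congruent to i. *)
Definition class_sum (F : numFieldType) (p : nat) (x : F) (E : seq (rat * int)) (i : 'F_p) :=
  \sum_(e <- E | e.2%:~R == i) ratr e.1 * x ^ e.2.

(** Fourier inversion over Z/p: averaging against the characters of Z/p
    isolates the exponents lying in one residue class. *)
Lemma class_sum_fourier (p : nat) (z x : algC) (E : seq (rat * int)) :
    prime p -> p.-primitive_root z -> x != 0 ->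
    (forall t, (0 < t < p)%N ->
       \sum_(e <- E) ratr e.1 * x ^ e.2 * (z ^ e.2) ^+ t = 0) ->
  forall i : 'F_p, class_sum x E i =
    p%:R^-1 * \sum_(e <- E) ratr e.1 * x ^ e.2.
Proof.
move=> p_pr zp x0 Et i; rewrite /class_sum.
have p0 : p%:R != 0 :> algC by rewrite pnatr_eq0 -lt0n prime_gt0.
have z0 : z != 0 by rewrite (prim_root_eq0 zp) -lt0n prime_gt0.
pose m : int := Posz i.
have mi : m%:~R = i :> 'F_p by rewrite /m; exact: natr_Zp.
apply: (mulfI p0); rewrite mulrA mulfV // mul1r.
transitivity (\sum_(e <- E) ratr e.1 * x ^ e.2 *
   \sum_(t < p) (z ^ (e.2 - m)) ^+ t).
  rewrite big_mkcond mulr_sumr; apply: eq_bigr => e _.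
  rewrite sum_expr_unity_root; last first.
    by rewrite exprnP exprzAC -exprnP (prim_expr_order zp) exp1rz.
  rewrite (exprz_prim_root_eq1 _ p_pr zp) rmorphB /= mi subr_eq0.
  by case: eqP => _; rewrite ?mulr0 // mulrC.
under eq_bigr do rewrite mulr_sumr.
rewrite exchange_big /=.
have -> : \sum_(e <- E) ratr e.1 * x ^ e.2 =
          \sum_(e <- E) ratr e.1 * x ^ e.2 * (z ^ (e.2 - m)) ^+ 0%N.
  by apply: eq_bigr => e _; rewrite expr0 mulr1.
rewrite (bigD1 (Ordinal (prime_gt0 p_pr))) //= [X in _ + X]big1 ?addr0 //.
move=> t t0; have {t0} t0 : (0 < t < p)%N.
  by rewrite lt0n -val_eqE /= in t0 *; rewrite t0 /=.
transitivity ((z ^ (- m)) ^+ t *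
    \sum_(e <- E) ratr e.1 * x ^ e.2 * (z ^ e.2) ^+ t).
  rewrite mulr_sumr; apply: eq_bigr => e _.
  by rewrite expfzDr // exprMn; ring.
by rewrite Et // mulr0.
Qed.

(** The automorphism of algC sending w to w^k fixes the rational coefficients. *)
Lemma relation_conj (N k : nat) (w : algC) (E : seq (rat * int)) :
    N.-primitive_root w -> coprime k N ->
    \sum_(e <- E) ratr e.1 * w ^ e.2 = 0 ->
  \sum_(e <- E) ratr e.1 * (w ^+ k) ^ e.2 = 0.
Proof.
move=> wN kN E0; have [u uE] := Qn_aut_exists kN.
have := congr1 u E0; rewrite rmorph0 rmorph_sum /= => Eu0; rewrite -[RHS]Eu0.
apply: eq_bigr => e _; rewrite rmorphM fmorph_rat /= uE.
  by rewrite exprnP exprzAC.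
by rewrite exprnP exprzAC -exprnP (prim_expr_order wN) exp1rz.
Qed.

Lemma prim_root_neq0 (N : nat) (w : algC) : N.-primitive_root w -> w != 0.
Proof. by move=> wN; rewrite (prim_root_eq0 wN) -lt0n (prim_order_gt0 wN). Qed.

(** As p divides N/p, every 1 + t N/p is prime to N; these conjugates of w differ
    from w by all the p-th roots of unity, so that the relation holds at all the
    characters of Z/p. *)
Lemma class_sum_sq (N p : nat) (w : algC) (E : seq (rat * int)) :
    prime p -> (p * p %| N)%N -> N.-primitive_root w ->
    \sum_(e <- E) ratr e.1 * w ^ e.2 = 0 ->
  forall i : 'F_p, class_sum w E i = 0.
Proof.
move=> p_pr /dvdnP [M NE] wN E0 i.
have zp : p.-primitive_root (w ^+ (N %/ p)).
  by apply: dvdn_prim_root => //; rewrite NE mulnA dvdn_mull.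
have w0 := prim_root_neq0 wN.
rewrite (class_sum_fourier p_pr zp w0) ?E0 ?mulr0 // => t _.
have NpE : (N %/ p = M * p)%N by rewrite NE mulnA mulnK // prime_gt0.
have cop : coprime (1 + t * (N %/ p)) N.
  apply: (@coprime_dvdr _ ((M * p) ^ 2)%N).
    by rewrite NE; apply/dvdnP; exists M; ring.
  by rewrite coprimeXr // NpE coprime_sym /coprime addnC gcdnMDl gcdn1.
rewrite -[RHS](relation_conj wN cop E0); apply: eq_bigr => e _.
rewrite -mulrA; congr (_ * _).
rewrite exprD expr1 expfzMl.
by congr (_ * _); rewrite mulnC exprM [in RHS]exprnP exprzAC -exprnP.
Qed.

(** Write w = x z with z of order p. The conjugates of w over x are the x z^t
    with t prime to p: the relation holds at the nontrivial characters of Z/p,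
    and the trivial one contributes the same amount S to every class. *)
Lemma class_sum_simple (M p : nat) (w : algC) (E : seq (rat * int)) :
    prime p -> coprime p M -> (p * M).-primitive_root w ->
    \sum_(e <- E) ratr e.1 * w ^ e.2 = 0 ->
  exists x S : algC, M.-primitive_root x /\
    forall i : 'F_p, class_sum x E i = S.
Proof.
move=> p_pr cop wN E0; set N := (p * M)%N in wN.
have p0 := prime_gt0 p_pr.
have M0 : (0 < M)%N by have := prim_order_gt0 wN; rewrite muln_gt0 => /andP [].
have xM : M.-primitive_root (w ^+ p).
  by have := dvdn_prim_root wN (dvdn_mull p (dvdnn M)); rewrite mulnK.
have zp : p.-primitive_root (w ^+ M).
  by have := dvdn_prim_root wN (dvdn_mulr M (dvdnn p)); rewrite mulKn.
(* c = 1 mod M, c = 0 mod p, c' = 0 mod M and c' = 1 mod p *)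
pose c := chinese p M 0 1; pose c' := chinese p M 1 0.
have cM : c = 1 %[mod M] by exact: chinese_modr.
have cp : c = 0 %[mod p] by exact: chinese_modl.
have c'M : c' = 0 %[mod M] by exact: chinese_modr.
have c'p : c' = 1 %[mod p] by exact: chinese_modl.
have c_p : (p %| c)%N by rewrite /dvdn cp mod0n.
have c_M : (M %| c')%N by rewrite /dvdn c'M mod0n.
exists (w ^+ c), (p%:R^-1 * \sum_(e <- E) ratr e.1 * (w ^+ c) ^ e.2); split.
  rewrite -(divnK c_p) mulnC exprM prim_root_exp_coprime //.
  have : coprime c M by rewrite -coprime_modl cM coprime_modl coprime1n.
  by apply: coprime_dvdl; rewrite -{2}(divnK c_p) dvdn_mulr.
have z'p : p.-primitive_root (w ^+ c').
  rewrite -(divnK c_M) mulnC exprM prim_root_exp_coprime //.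
  have : coprime c' p by rewrite -coprime_modl c'p coprime_modl coprime1n.
  by apply: coprime_dvdl; rewrite -{2}(divnK c_M) dvdn_mulr.
apply: (class_sum_fourier p_pr z'p).
  by rewrite expf_neq0 // (prim_root_neq0 wN).
move=> t /andP [t0 tp].
have copt : coprime (c + t * c') N.
  rewrite coprimeMr; apply/andP; split.
    rewrite -coprime_modl -modnDm cp -modnMm c'p modnMm muln1 modnDm add0n.
    by rewrite coprime_modl coprime_sym prime_coprime // gtnNdvd.
  rewrite -coprime_modl -modnDm cM -modnMm c'M modnMm muln0 modnDm addn0.
  by rewrite coprime_modl coprime1n.
rewrite -[RHS](relation_conj wN copt E0); apply: eq_bigr => e _.
rewrite -mulrA; congr (_ * _).
rewrite exprD expfzMl.
by congr (_ * _); rewrite mulnC exprM [in RHS]exprnP exprzAC -exprnP.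
Qed.

Lemma ratr_eq0 (a : rat) : (ratr a == 0 :> algC) = (a == 0).
Proof. exact: fmorph_eq0. Qed.

Lemma natFp_neq0 (p n : nat) : prime p -> (0 < n < p)%N -> n%:R != 0 :> 'F_p.
Proof.
move=> p_pr /andP [n0 np].
by rewrite -(dvdn_pcharf (pchar_Fp p_pr)) gtnNdvd.
Qed.

Lemma conjC_exprz (M : nat) (x : algC) (e : int) :
  M.-primitive_root x -> (x ^ e)^* = x ^ (- e).
Proof.
move=> xM; have x1 : `|x| = 1.
  apply/eqP; rewrite -(pexpr_eq1 (prim_order_gt0 xM)) //.
  by rewrite -normrX (prim_expr_order xM) normr1.
have x0 := prim_root_neq0 xM.
rewrite rmorphXz ?unitfE //= -exprz_inv; congr (_ ^ _).
by rewrite invC_norm x1 expr1n invr1 mul1r.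
Qed.

(** Complex conjugation fixes the coefficients and inverts the root of unity. *)
Lemma rat_collinear_prim_root (M : nat) (x : algC) (a b : rat) (e f : int) :
    M.-primitive_root x -> ratr a * x ^ e = ratr b * x ^ f -> a != 0 ->
  x ^ ((e - f) * 2) = 1.
Proof.
move=> xM ab a0; have x0 := prim_root_neq0 xM.
have a0' : ratr a != 0 :> algC by rewrite ratr_eq0.
have xf (m : int) : x ^ m != 0 by rewrite expfz_neq0.
have ab1 : ratr a * x ^ (e - f) = ratr b.
  by rewrite expfzDr // mulrA ab -mulrA -expfzDr // subrr mulr1.
have := congr1 (fun z => z^*) ab1; rewrite /= rmorphM /= (conjC_exprz _ xM).
rewrite -!/(Num.conj _) !fmorph_rat -[in RHS]ab1 => /(mulfI a0') efE.
have -> : (e - f) * 2 = (e - f) + (e - f) :> int by ring.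
by rewrite expfzDr // -{1}efE -expfzDr // addNr.
Qed.

Lemma odd_unity_sq (M : nat) (x : algC) (e : int) :
  odd M -> M.-primitive_root x -> x ^ (e * 2) = 1 -> x ^ e = 1.
Proof.
move=> oM xM; rewrite -exprz_exp => y2.
have : (x ^ e) ^+ M = 1 by rewrite exprnP exprzAC -exprnP (prim_expr_order xM) exp1rz.
rewrite -(odd_double_half M) oM -muln2 mulnC exprD exprM.
by rewrite [_ ^+ 2]y2 expr1n mulr1.
Qed.

(** [cosz w e] is the Laurent form of 2 cos(e t) at w = exp(i t). *)
Definition cosz (F : fieldType) (w : F) (e : int) : F := w ^ e + w ^ (- e).

Lemma coszN (F : fieldType) (w : F) e : cosz w (- e) = cosz w e.
Proof. by rewrite /cosz opprK addrC. Qed.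

(** Exponents and coefficients of the relation between powers of w that expresses
    that the matrix (a b // c d) sends 2 cos t to 2 cos(k t). *)
Definition moebius_rel (c d a b : rat) (k : int) : seq (rat * int) :=
  [:: (c, k + 1); (c, - (k + 1)); (c, k - 1); (c, - (k - 1));
      (d, k); (d, - k); (- a, 1); (- a, - 1); (- b, 0)].

Lemma moebius_relE (F : numFieldType) (w : F) c d a b k : w != 0 ->
    (ratr c * cosz w 1 + ratr d) * cosz w k = ratr a * cosz w 1 + ratr b ->
  \sum_(e <- moebius_rel c d a b k) ratr e.1 * w ^ e.2 = 0.
Proof.
move=> w0 /eqP; rewrite -subr_eq0 /cosz => /eqP rel.
rewrite -[RHS]rel !big_cons big_nil /= !rmorphN /= !opprD !opprK.
rewrite !expfzDr // expr0z.
ring.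
Qed.

Lemma class_sum_moebius (F : numFieldType) p (x : F) c d a b k (i : 'F_p) :
  class_sum x (moebius_rel c d a b k) i =
    (k%:~R + 1 == i)%:R * (ratr c * x ^ (k + 1)) +
    (- (k%:~R + 1) == i)%:R * (ratr c * x ^ (- (k + 1))) +
    (k%:~R - 1 == i)%:R * (ratr c * x ^ (k - 1)) +
    (- (k%:~R - 1) == i)%:R * (ratr c * x ^ (- (k - 1))) +
    (k%:~R == i)%:R * (ratr d * x ^ k) +
    (- k%:~R == i)%:R * (ratr d * x ^ (- k)) -
    (1 == i)%:R * (ratr a * x) - (- 1 == i)%:R * (ratr a * x^-1) -
    (0 == i)%:R * ratr b.
Proof.
rewrite /class_sum big_mkcond !big_cons big_nil /= !rmorphN /= !rmorphD !rmorphN /=.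
have ifE (t : bool) (u : F) : (if t then u else 0) = t%:R * u.
  by case: t; rewrite ?mul1r ?mul0r.
rewrite !ifE expr0z expr1z exprN1 !mulr1z !mulr0z; ring.
Qed.

Lemma eqF_sub (V : zmodType) (u A B : V) : u != 0 -> A - B = u -> (A == B) = false.
Proof. by move=> u0 ABu; rewrite -subr_eq0 ABu (negbTE u0). Qed.

(* Settles the congruences between exponents: A = B when ring proves it, and
   A <> B when A - B is, up to sign, one of the nonzero elements in context. *)
Ltac Fp_decide := repeat match goal with
  | |- context [(?A == ?B)] =>
    first [ have -> : (A == B) = true by apply/eqP; ring
          | match goal with u0 : is_true (?u != 0) |- _ =>
              first [ have -> : (A == B) = false by apply: (eqF_sub u0); ring
                    | have -> : (A == B) = false by rewrite eq_sym; apply: (eqF_sub u0); ring ]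
            end ]
  end; rewrite /=.

Lemma exprz_relation0 (x : algC) (a : rat) (e : int) :
  x != 0 -> ratr a * x ^ e = 0 -> a = 0.
Proof.
move=> x0 /eqP; rewrite mulf_eq0 ratr_eq0 (negbTE (expfz_neq0 e x0)) orbF.
by move/eqP.
Qed.

Definition bool_simp := (mulr1n, mulr0n, mul1r, mul0r, addr0, add0r, subr0, sub0r, oppr0).

(** The inequalities say that no other exponent is congruent to k + 1, so that
    c = 0; then k is alone in its class as well. *)
Lemma class_sum_isolated p (x : algC) c d a b k :
    prime p -> (3 <= p)%N -> x != 0 ->
    (forall i : 'F_p, class_sum x (moebius_rel c d a b k) i = 0) ->
    let q : 'F_p := k%:~R in
    q != 0 -> q + 1 != 0 -> q - 1 != 0 -> 2 * q + 1 != 0 -> q + 2 != 0 ->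
  c = 0 /\ d = 0.
Proof.
move=> p_pr p3 x0 CS q q0 q1 q1' q2 q2'.
have n1 : 1 != 0 :> 'F_p by apply: oner_neq0.
have n2 : 2 != 0 :> 'F_p by apply: (@natFp_neq0 p 2) => //; lia.
have n2q : 2 * q != 0 by rewrite mulf_neq0.
have n2q1 : 2 * (q + 1) != 0 by rewrite mulf_neq0.
have c0 : c = 0.
  have := CS (q + 1); rewrite class_sum_moebius -/q.
  by Fp_decide; rewrite !bool_simp; apply: exprz_relation0.
split=> //; have := CS q; rewrite class_sum_moebius -/q c0 rmorph0.
by Fp_decide; rewrite !(bool_simp, mulr0); apply: exprz_relation0.
Qed.

(** With fewer exponents than residues, some class is empty. *)
Lemma class_sum_missing p (x : algC) (E : seq (rat * int)) S :
    prime p -> (size E < p)%N ->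
    (forall i : 'F_p, class_sum x E i = S) -> S = 0.
Proof.
move=> p_pr pE CS.
have [i iE] : exists i : 'F_p, i \notin [seq e.2%:~R | e <- E].
  apply/existsP; apply: contraLR pE => /existsPn iE; rewrite -leqNgt.
  have := @uniq_leq_size _ (enum 'F_p) [seq e.2%:~R | e <- E] (enum_uniq _).
  move=> En; rewrite -[X in (X <= _)%N](card_Fp p_pr) cardT -(size_map (fun e => e.2%:~R : 'F_p)).
  by apply: En => i _; apply/negPn/iE.
rewrite -(CS i) /class_sum big_seq_cond big_pred0 // => e.
apply/negbTE/negP => /andP [eE /eqP ei]; move/negP: iE; apply.
by apply/mapP; exists e.
Qed.

(** For k = 1 mod p the exponent k + 1 is alone in the class of 2. *)
Lemma class_sum_one p (x : algC) c d a b k :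
    prime p -> (5 <= p)%N -> x != 0 ->
    (forall i : 'F_p, class_sum x (moebius_rel c d a b k) i = 0) ->
    k%:~R = 1 :> 'F_p ->
  [/\ c = 0, b = 0 & ratr d * x ^ k = ratr a * x].
Proof.
move=> p_pr p5 x0 CS q1.
have n1 : 1 != 0 :> 'F_p by apply: oner_neq0.
have n2 : 2 != 0 :> 'F_p by apply: (@natFp_neq0 p 2) => //; lia.
have n3 : 3 != 0 :> 'F_p by apply: (@natFp_neq0 p 3) => //; lia.
have n4 : 4 != 0 :> 'F_p by apply: (@natFp_neq0 p 4) => //; lia.
have c0 : c = 0.
  have := CS 2; rewrite class_sum_moebius q1.
  by Fp_decide; rewrite !bool_simp; apply: exprz_relation0.
rewrite {}c0 in CS *; split=> //.
  have := CS 0; rewrite class_sum_moebius q1 rmorph0; Fp_decide.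
  rewrite !(bool_simp, mulr0) => /eqP.
  by rewrite oppr_eq0 ratr_eq0 => /eqP.
have := CS 1; rewrite class_sum_moebius q1 rmorph0; Fp_decide.
by rewrite !(bool_simp, mulr0) => /eqP; rewrite subr_eq0 => /eqP.
Qed.

(** For k = 1 mod p the exponents only meet the classes 0, 1, -1, 2, -2. *)
Lemma class_sum_one_seven p (x : algC) c d a b k S :
    prime p -> (7 <= p)%N ->
    (forall i : 'F_p, class_sum x (moebius_rel c d a b k) i = S) ->
    k%:~R = 1 :> 'F_p -> S = 0.
Proof.
move=> p_pr p7 CS q1.
have n1 : 1 != 0 :> 'F_p by apply: oner_neq0.
have n2 : 2 != 0 :> 'F_p by apply: (@natFp_neq0 p 2) => //; lia.
have n3 : 3 != 0 :> 'F_p by apply: (@natFp_neq0 p 3) => //; lia.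
have n4 : 4 != 0 :> 'F_p by apply: (@natFp_neq0 p 4) => //; lia.
have n5 : 5 != 0 :> 'F_p by apply: (@natFp_neq0 p 5) => //; lia.
rewrite -(CS 3) class_sum_moebius q1; Fp_decide.
by rewrite !bool_simp.
Qed.

Ltac Fp_compute := repeat match goal with
  | |- context [(?A == ?B)] =>
    first [ have -> : (A == B) = true by []
          | have -> : (A == B) = false by [] ]
  end; rewrite /=.

(** Modulo 7 the exponents meet all the classes, and S may be nonzero. But - b is
    alone in the class of 0 and some a x or d x^k is alone in another class; being
    equal, they vanish, since no power of x involved is rational. *)
Lemma class_sum_seven (M : nat) (x : algC) c d a b k S :
    odd M -> M.-primitive_root x -> x != 1 -> x ^ k != 1 ->
    (forall i : 'F_7, class_sum x (moebius_rel c d a b k) i = S) ->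
    k%:~R = 2 :> 'F_7 \/ k%:~R = 3 :> 'F_7 ->
  c = 0 /\ d = 0.
Proof.
move=> oM xM x1 xk1 CS kE; have x0 := prim_root_neq0 xM.
have bS : - ratr b = S.
  rewrite -(CS 0) class_sum_moebius; case: kE => ->; Fp_compute;
  by rewrite !bool_simp.
have rat_eq0 (r : rat) (e : int) : x ^ e != 1 -> ratr r * x ^ e = ratr b -> r = 0.
  move=> xe1 rb; apply/eqP; apply: contraNT xe1 => r0.
  apply/eqP; apply: (odd_unity_sq oM xM).
  have := rat_collinear_prim_root (b := b) (f := 0) xM.
  by rewrite expr0z mulr1 => /(_ _ _ rb r0); rewrite subr0.
case: kE => kE.
  have d0 : d = 0.
    apply/eqP; rewrite -oppr_eq0; apply/eqP; apply: (rat_eq0 _ k) => //.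
    apply: oppr_inj; rewrite bS -(CS 2) class_sum_moebius kE; Fp_compute.
    by rewrite !bool_simp rmorphN mulNr opprK.
  have S0 : S = 0.
    rewrite -(CS 2) class_sum_moebius kE d0; Fp_compute.
    by rewrite !(bool_simp, rmorph0, mul0r).
  split=> //; have := CS 3; rewrite S0 class_sum_moebius kE; Fp_compute.
  by rewrite !bool_simp; apply: exprz_relation0.
have a0 : a = 0.
  apply: (rat_eq0 _ 1) => //.
  apply: oppr_inj; rewrite bS -(CS 1) class_sum_moebius kE; Fp_compute.
  by rewrite !bool_simp.
have S0 : S = 0.
  rewrite -(CS 1) class_sum_moebius kE a0; Fp_compute.
  by rewrite !(bool_simp, rmorph0, mul0r).
have c0 : c = 0.
  have := CS 2; rewrite S0 class_sum_moebius kE; Fp_compute.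
  by rewrite !bool_simp; apply: exprz_relation0.
split=> //; have := CS 3; rewrite S0 class_sum_moebius kE c0; Fp_compute.
by rewrite !(bool_simp, rmorph0, mul0r); apply: exprz_relation0.
Qed.

(** * Moebius relations between conjugate cosines: odd order *)

(** Consider the prime factors of m / gcd(m, 15): a factor 3 or 5 would divide m
    twice. *)
Lemma odd_large_prime (m : nat) : odd m -> m \notin [:: 1; 3; 5; 15]%N ->
  [\/ exists p, [/\ prime p, (7 <= p)%N & (p %| m)%N],
      (5 * 5 %| m)%N | (3 * 3 %| m)%N].
Proof.
move=> om m_notin; pose g := gcdn m 15; pose r := (m %/ g)%N.
have m0 : (0 < m)%N by case: (m) om.
have mE : m = (r * g)%N by rewrite /r divnK // dvdn_gcdl.
have r_m : (r %| m)%N by rewrite mE dvdn_mulr.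
have r1 : (1 < r)%N.
  rewrite ltn_neqAle (_ : (0 < r)%N); last by rewrite mE muln_gt0 in m0; case/andP: m0.
  rewrite andbT; apply: contra m_notin => /eqP r1.
  have m15 : (m %| 15)%N by rewrite mE -r1 mul1n dvdn_gcdr.
  have /allP /(_ m) : all (fun s => (s %| 15)%N ==> (s \in [:: 1; 3; 5; 15]%N)) (iota 0 16).
    by [].
  by rewrite mem_iota m15 /= ltnS (dvdn_leq _ m15) // => /(_ isT).
have q_pr := pdiv_prime r1; have q_r := pdiv_dvd r; set q := pdiv r in q_pr q_r.
have q_m := dvdn_trans q_r r_m.
have [q7|q7] := leqP 7 q; first by constructor 1; exists q.
have sq (s : nat) : (s %| 15)%N -> (s %| r)%N -> (s * s %| m)%N.
  by move=> s15 sr; rewrite mE dvdn_mul // dvdn_gcd s15 (dvdn_trans sr r_m).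
have [q3|q3] := eqVneq q 3%N; first by constructor 3; apply: sq => //; rewrite -q3.
have [q5|q5] := eqVneq q 5%N; first by constructor 2; apply: sq => //; rewrite -q5.
have oq : odd q by apply: dvdn_odd om.
by move: q_pr oq q3 q5 q7; case: (q) => [|[|[|[|[|[|[|]]]]]]].
Qed.

Lemma prim_root_exprz_eq1 (N : nat) (w : algC) (e : int) :
  N.-primitive_root w -> (w ^ e == 1) = (N %| `|e|)%N.
Proof.
move=> wN; rewrite (prim_order_dvd wN); case: e => n //=.
by rewrite NegzE -exprnN invr_eq1.
Qed.

(** The power x^(k - 1) is rational, hence 1 as the order is odd. *)
Lemma diagonal_moebius (M : nat) (x : algC) (a d : rat) (k : int) :
    odd M -> M.-primitive_root x -> d != 0 -> ratr d * x ^ k = ratr a * x ->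
  a = d.
Proof.
move=> oM xM d0 da; have x0 := prim_root_neq0 xM.
have xk1 : x ^ (k - 1) = 1.
  exact/(odd_unity_sq oM xM)/(rat_collinear_prim_root (f := 1) xM da d0).
have xkE : x ^ k = x by rewrite -[k](subrK 1) expfzDr // xk1 mul1r.
by move: da; rewrite xkE => /(mulIf x0) /fmorph_inj.
Qed.

Definition trivial_moebius (c d a b : rat) := [/\ c = 0, b = 0 & a = d].

Lemma int_Fp_neq0 (p : nat) (k : int) :
  prime p -> coprime `|k| p -> k%:~R != 0 :> 'F_p.
Proof.
move=> p_pr kp; suff : (`|k|%N)%:R != 0 :> 'F_p.
  by case: k {kp} => n //=; rewrite NegzE rmorphN oppr_eq0.
rewrite -(dvdn_pcharf (pchar_Fp p_pr)) -prime_coprime // coprime_sym //.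
Qed.

(** Replacing k by - k leaves the relation unchanged, which halves the cases. *)
Lemma moebius_sign (w : algC) (c d a b : rat) (k : int) (P : int -> Prop) :
    (ratr c * cosz w 1 + ratr d) * cosz w k = ratr a * cosz w 1 + ratr b ->
    P k \/ P (- k) ->
  exists k' : int, [/\ P k', `|k'|%N = `|k|%N &
    (ratr c * cosz w 1 + ratr d) * cosz w k' = ratr a * cosz w 1 + ratr b].
Proof.
move=> rel []; first by exists k.
by exists (- k); split=> //; rewrite ?abszN ?coszN.
Qed.

(** The common value S is 0 when p divides N/p, but may be nonzero otherwise:
    the p-th roots of unity other than 1 add up to -1. *)
Lemma class_sum_prime (p N : nat) (w : algC) (E : seq (rat * int)) :
    prime p -> (p %| N)%N -> N.-primitive_root w ->
    \sum_(e <- E) ratr e.1 * w ^ e.2 = 0 ->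
  exists (M : nat) (x S : algC), [/\ (M %| N)%N, (N %| p * M)%N,
    M.-primitive_root x & forall i : 'F_p, class_sum x E i = S].
Proof.
move=> p_pr pN wN E0; have [M NE] := dvdnP pN; have p0 := prime_gt0 p_pr.
have [pM|pM] := boolP (p %| M)%N.
  exists N, w, 0; split=> //; first exact: dvdn_mull.
  by apply: (class_sum_sq p_pr _ wN E0); rewrite NE dvdn_mul.
rewrite NE mulnC in wN; have cop : coprime p M by rewrite prime_coprime.
have [x [S [xM CS]]] := class_sum_simple p_pr cop wN E0.
exists M, x, S; split=> //; first by rewrite NE dvdn_mulr.
by rewrite NE mulnC.
Qed.

(** If k is 1 or -1 mod p, the relation is the trivial one. Otherwise a class with
    a single exponent forces c = d = 0; for p >= 11 this uses S = 0, and for p = 7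
    that x is not 1, which is where m = 7 is excluded. *)
Lemma odd_moebius_large_prime (m p : nat) (w : algC) (c d a b : rat) (k : int) :
    prime p -> (7 <= p)%N -> (p %| m)%N -> odd m -> m != 7%N ->
    m.-primitive_root w -> coprime `|k| m ->
    (ratr c * cosz w 1 + ratr d) * cosz w k = ratr a * cosz w 1 + ratr b ->
    c != 0 \/ d != 0 ->
  trivial_moebius c d a b.
Proof.
move=> p_pr p7 pm om m7 wm km rel cd; have w0 := prim_root_neq0 wm.
have kp : coprime `|k| p by apply: coprime_dvdr km.
have cd_contra : ~ (c = 0 /\ d = 0) by case=> c0 d0; case: cd => /eqP.
have n1 : 1 != 0 :> 'F_p by apply: oner_neq0.
have n2 : 2%:R != 0 :> 'F_p by apply: natFp_neq0; rewrite ?(leq_trans _ p7).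
have n3 : 3%:R != 0 :> 'F_p by apply: natFp_neq0; rewrite ?(leq_trans _ p7).
have n4 : 4%:R != 0 :> 'F_p by apply: natFp_neq0; rewrite ?(leq_trans _ p7).
have n5 : 5%:R != 0 :> 'F_p by apply: natFp_neq0; rewrite ?(leq_trans _ p7).
have [k1|] := boolP ((k%:~R == 1 :> 'F_p) || (- k%:~R == 1 :> 'F_p)).
  have [|k' [k'1 k'E {}rel]] := moebius_sign (P := fun k => k%:~R = 1 :> 'F_p) rel.
    by case/orP: k1 => /eqP k1; [left | right; rewrite rmorphN].
  have E0 := moebius_relE w0 rel.
  have [M [x [S [Mm _ xM CS]]]] := class_sum_prime p_pr pm wm E0.
  have S0 := class_sum_one_seven p_pr p7 CS k'1.
  rewrite {}S0 in CS; have p5 : (5 <= p)%N by apply: leq_trans p7.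
  have [c0 b0 da] := class_sum_one p_pr p5 (prim_root_neq0 xM) CS k'1.
  split=> //; apply: (diagonal_moebius _ xM) da; first exact: dvdn_odd om.
  by case: cd => //; rewrite c0 eqxx.
rewrite negb_or => /andP [k1 k1'].
have [p11|p11] := leqP 11 p.
  pose P (k : int) := let q : 'F_p := k%:~R in
    [/\ q != 0, q + 1 != 0, q - 1 != 0, 2 * q + 1 != 0 & q + 2 != 0].
  have [|k' [[q0 q1 q1' q2 q2'] k'E {}rel]] := moebius_sign (P := P) rel.
    have k0 := int_Fp_neq0 p_pr kp.
    have kD1 : k%:~R + 1 != 0 :> 'F_p by rewrite addr_eq0 eqr_oppLR // in k1' *.
    have kB1 : k%:~R - 1 != 0 :> 'F_p by rewrite subr_eq0.
    rewrite /P rmorphN /=; set q : 'F_p := k%:~R in k0 kD1 kB1 *.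
    have [e|e] := eqVneq (2 * q + 1) 0; [right|have [e'|e'] := eqVneq (q + 2) 0; [right|left]].
    + split; rewrite ?oppr_eq0 //.
      * by rewrite -oppr_eq0 opprD opprK.
      * by rewrite -oppr_eq0 opprD !opprK.
      * have -> : 2 * - q + 1 = 2 - (2 * q + 1) by ring.
        by rewrite e subr0; exact: n2.
      * apply: contraNneq n5 => e2; have -> : 5%:R = (2 * q + 1) + 2 * (- q + 2) by ring.
        by rewrite e e2 mulr0 addr0.
    + split; rewrite ?oppr_eq0 //.
      * by rewrite -oppr_eq0 opprD opprK.
      * by rewrite -oppr_eq0 opprD !opprK.
      * have -> : 2 * - q + 1 = 5 - 2 * (q + 2) by ring.
        by rewrite e' mulr0 subr0; exact: n5.
      * have -> : - q + 2 = 4 - (q + 2) by ring.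
        by rewrite e' subr0; exact: n4.
    + by [].
  have E0 := moebius_relE w0 rel.
  have [M [x [S [Mm _ xM CS]]]] := class_sum_prime p_pr pm wm E0.
  have p9 : (size (moebius_rel c d a b k') < p)%N by apply: leq_trans p11.
  case: cd_contra; have S0 := class_sum_missing p_pr p9 CS; rewrite {}S0 in CS.
  have p3 : (3 <= p)%N by apply: leq_trans p7.
  exact: (class_sum_isolated p_pr p3 (prim_root_neq0 xM) CS q0 q1 q1' q2 q2').
have p_eq7 : p = 7%N.
  by move: p_pr p7 p11; case: (p) => [|[|[|[|[|[|[|[|[|[|[|]]]]]]]]]]].
subst p; have {}k1 : k%:~R != 1 :> 'F_7 by [].
pose P (k : int) := k%:~R = 2 :> 'F_7 \/ k%:~R = 3 :> 'F_7.
have [|k' [k'P k'E {}rel]] := moebius_sign (P := P) rel.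
  have := int_Fp_neq0 p_pr kp; rewrite /P rmorphN /=.
  move: (k%:~R : 'F_7) k1 k1' => q.
  case: q => [[|[|[|[|[|[|[|q]]]]]]] //= qlt] //= _ _ _.
  - by left; left; apply/val_inj.
  - by left; right; apply/val_inj.
  - by right; right; apply/val_inj.
  - by right; left; apply/val_inj.
have E0 := moebius_relE w0 rel.
have [M [x [S [Mm mM xM CS]]]] := class_sum_prime p_pr pm wm E0.
have M1 : M != 1%N.
  by apply: contraNneq m7 => M1; rewrite M1 muln1 in mM; rewrite eqn_dvd mM pm.
case: cd_contra; apply: (class_sum_seven _ xM _ _ CS) => //.
- exact: dvdn_odd om.
- by rewrite -[x]expr1z (prim_root_exprz_eq1 _ xM) dvdn1.
rewrite (prim_root_exprz_eq1 _ xM) k'E; apply: contra M1 => Mk.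
by rewrite -dvdn1 -(eqP km) dvdn_gcd Mk.
Qed.

(** All class sums vanish, but modulo 5 and for k = 2 no exponent with coefficient
    c is alone in its class. The two colliding pairs give w^(k - 2) = 1 and
    w^(2 k + 1) = 1, whence w^5 = 1. *)
Lemma odd_moebius_five (m : nat) (w : algC) (c d a b : rat) (k : int) :
    (5 * 5 %| m)%N -> odd m -> m.-primitive_root w -> coprime `|k| m ->
    (ratr c * cosz w 1 + ratr d) * cosz w k = ratr a * cosz w 1 + ratr b ->
    c != 0 \/ d != 0 ->
  trivial_moebius c d a b.
Proof.
move=> m25 om wm km rel cd; have w0 := prim_root_neq0 wm.
have k5 : coprime `|k| 5 by apply: coprime_dvdr km; apply: dvdn_trans m25.
pose P (k : int) := k%:~R = 1 :> 'F_5 \/ k%:~R = 2 :> 'F_5.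
have [|k' [k'P _ {}rel]] := moebius_sign (P := P) rel.
  have := int_Fp_neq0 (isT : prime 5) k5; rewrite /P rmorphN /=.
  move: (k%:~R : 'F_5) => q.
  case: q => [[|[|[|[|[|q]]]]] //= qlt] //= _.
  - by left; left; apply/val_inj.
  - by left; right; apply/val_inj.
  - by right; right; apply/val_inj.
  - by right; left; apply/val_inj.
have CS : forall i : 'F_5, class_sum w (moebius_rel c d a b k') i = 0.
  exact: (class_sum_sq _ m25 wm (moebius_relE w0 rel)).
case: k'P => k'E.
  have [c0 b0 da] := class_sum_one (isT : prime 5) (leqnn 5) w0 CS k'E.
  split=> //; apply: (diagonal_moebius om wm) da.
  by case: cd => //; rewrite c0 eqxx.
have ca : ratr c * w ^ (k' - 1) = ratr a * w ^ 1.
  have := CS 1; rewrite class_sum_moebius k'E; Fp_compute.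
  by rewrite !bool_simp => /eqP; rewrite subr_eq0 => /eqP.
have cd0 : ratr c * w ^ (- (k' + 1)) = ratr (- d) * w ^ k'.
  have := CS 2; rewrite class_sum_moebius k'E; Fp_compute.
  rewrite !bool_simp => /eqP; rewrite addr_eq0 => /eqP ->.
  by rewrite rmorphN mulNr.
have [c0|c0] := eqVneq c 0.
  case: cd; first by rewrite c0 eqxx.
  move: cd0; rewrite c0 rmorph0 mul0r => /esym /(exprz_relation0 w0) /eqP.
  by rewrite oppr_eq0 => ->.
(* the two collisions at 1 and at 2 would make w a fifth root of unity *)
have e1 := odd_unity_sq om wm (rat_collinear_prim_root wm ca c0).
have e2 := odd_unity_sq om wm (rat_collinear_prim_root wm cd0 c0).
have : w ^ (- ((- (k' + 1) - k') + (k' - 1 - 1) * 2)) == 1.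
  by rewrite -invr_expz expfzDr // e2 mul1r -exprz_exp e1 exp1rz invr1.
have -> : - ((- (k' + 1) - k') + (k' - 1 - 1) * 2) = 5 :> int by ring.
rewrite (prim_root_exprz_eq1 _ wm) /= => m5.
by have := dvdn_trans m25 m5.
Qed.

(** All class sums vanish, but modulo 3 the collisions are worse: if c is nonzero,
    class 0 makes v = w^(k - 1) a cube root of unity, and comparing class 1 with
    its conjugate under w -> w^4, which fixes v, gives w^9 = 1. *)
Lemma odd_moebius_three (m : nat) (w : algC) (c d a b : rat) (k : int) :
    (3 * 3 %| m)%N -> m != 9%N -> odd m -> m.-primitive_root w -> coprime `|k| m ->
    (ratr c * cosz w 1 + ratr d) * cosz w k = ratr a * cosz w 1 + ratr b ->
    c != 0 \/ d != 0 ->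
  trivial_moebius c d a b.
Proof.
move=> m3 m9 om wm km rel cd; have w0 := prim_root_neq0 wm.
have k3 : coprime `|k| 3 by apply: coprime_dvdr km; apply: dvdn_trans m3.
have [|k' [k'E _ {}rel]] := moebius_sign (P := fun k => k%:~R = 1 :> 'F_3) rel.
  have := int_Fp_neq0 (isT : prime 3) k3; rewrite rmorphN /=.
  move: (k%:~R : 'F_3) => q.
  case: q => [[|[|[|q]]] //= qlt] //= _.
  - by left; apply/val_inj.
  - by right; apply/val_inj.
have CS : forall i : 'F_3, class_sum w (moebius_rel c d a b k') i = 0.
  exact: (class_sum_sq _ m3 wm (moebius_relE w0 rel)).
have C0 : ratr c * w ^ (k' - 1) + ratr c * w ^ (- (k' - 1)) = ratr b.
  have := CS 0; rewrite class_sum_moebius k'E; Fp_compute.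
  by rewrite !bool_simp => /eqP; rewrite subr_eq0 => /eqP.
have C1 : ratr c * w ^ (- (k' + 1)) + ratr d * w ^ k' - ratr a * w = 0.
  have := CS 1; rewrite class_sum_moebius k'E; Fp_compute.
  by rewrite !bool_simp.
have [c0|c0] := eqVneq c 0.
  have b0 : b = 0.
    by apply/eqP; rewrite -ratr_eq0 -C0 c0 rmorph0 !mul0r addr0.
  split=> //; apply: (diagonal_moebius om wm (k := k')).
    by case: cd => //; rewrite c0 eqxx.
  by apply/eqP; rewrite -subr_eq0 -[X in _ == X]C1 c0 rmorph0 mul0r add0r.
have c0' : ratr c != 0 :> algC by rewrite ratr_eq0.
set v := w ^ (k' - 1); have v0 : v != 0 by rewrite expfz_neq0.
(* v + 1/v is rational, hence equal to its conjugate v^2 + 1/v^2 *)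
have vN : w ^ (- (k' - 1)) = v^-1 by rewrite invr_expz.
have wkE : w ^ k' = v * w by rewrite -{1}[k'](subrK 1) expfzDr // expr1z.
have wkE' : w ^ (- (k' + 1)) = v^-1 * w ^- 2.
  transitivity (w ^ (- (k' - 1)) * w ^ (- 2%:Z)); last by rewrite vN exprnN.
  by rewrite -expfzDr //; congr (_ ^ _); lia.
have v3 : v ^+ 3 = 1.
  have C0' : \sum_(e <- [:: (c, k' - 1); (c, - (k' - 1)); (- b, 0)])
      ratr e.1 * w ^ e.2 = 0.
    by rewrite !big_cons big_nil /= rmorphN /= expr0z mulr1 addr0 addrA C0 subrr.
  have w2m : coprime 2 m by rewrite coprime2n.
  have := relation_conj wm w2m C0'.
  rewrite !big_cons big_nil /= rmorphN /= expr0z mulr1 addr0 addrA -C0.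
  have exprE (e : int) : (w ^+ 2) ^ e = (w ^ e) ^+ 2 by rewrite exprnP exprzAC.
  rewrite !exprE vN -/v -!mulrDr -mulrBr => /eqP; rewrite mulf_eq0 (negbTE c0') /= => /eqP vE.
  have : (v - 1) * (v ^+ 3 - 1) = 0.
    have -> : (v - 1) * (v ^+ 3 - 1) = v ^+ 2 * (v ^+ 2 + v^-1 ^+ 2 - (v + v^-1)).
      by field.
    by rewrite vE mulr0.
  move/eqP; rewrite mulf_eq0 !subr_eq0 => /orP [] /eqP // ->.
  by rewrite expr1n.
(* conjugation by w -> w^4 fixes the cube root of unity v *)
have C1' : \sum_(e <- [:: (c, - (k' + 1)); (d, k'); (- a, 1)])
    ratr e.1 * w ^ e.2 = 0.
  by rewrite !big_cons big_nil /= rmorphN /= expr1z mulNr addr0 addrA C1.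
have w4m : coprime 4 m by rewrite (@coprimeXl 2 2) // coprime2n.
have := relation_conj wm w4m C1'.
rewrite !big_cons big_nil /= rmorphN /= expr1z mulNr addr0 addrA.
have exprE (e : int) : (w ^+ 4) ^ e = (w ^ e) ^+ 4 by rewrite exprnP exprzAC.
rewrite !exprE wkE wkE' !exprMn => C4.
have v4 : v ^+ 4 = v by rewrite exprS v3 mulr1.
have v4' : v^-1 ^+ 4 = v^-1 by rewrite exprVn v4.
rewrite v4 v4' in C4; rewrite wkE wkE' in C1.
have w9 : w ^+ 9 = 1.
  have : ratr c * (w ^+ 9 - 1) = 0.
    have -> : ratr c * (w ^+ 9 - 1) = v * w ^+ 8 * (w ^+ 3 *
        (ratr c * (v^-1 * w ^- 2) + ratr d * (v * w) - ratr a * w) -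
        (ratr c * (v^-1 * w ^- 2 ^+ 4) + ratr d * (v * w ^+ 4) - ratr a * w ^+ 4)).
      by field; rewrite v0 w0.
    by rewrite C1 C4 mulr0 subrr mulr0.
  by move/eqP; rewrite mulf_eq0 (negbTE c0') subr_eq0 => /eqP.
have : (m %| 9)%N by rewrite (prim_order_dvd wm) w9.
move=> m_9; have := @dvdn_leq m 9 isT m_9; have := dvdn_leq (prim_order_gt0 wm) m3.
by move=> /= m9l m9g; rewrite eqn_leq m9l m9g in m9.
Qed.

(** The orders excluded are those m for which no prime factor gives enough residue
    classes, namely the divisors of 15, 7 and 9. *)
Lemma odd_moebius (m : nat) (w : algC) (c d a b : rat) (k : int) :
    odd m -> m \notin [:: 1; 3; 5; 7; 9; 15]%N ->
    m.-primitive_root w -> coprime `|k| m ->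
    (ratr c * cosz w 1 + ratr d) * cosz w k = ratr a * cosz w 1 + ratr b ->
    c != 0 \/ d != 0 ->
  trivial_moebius c d a b.
Proof.
move=> om m_notin wm km rel cd.
have m7 : m != 7%N by apply: contraNneq m_notin => ->.
have m9 : m != 9%N by apply: contraNneq m_notin => ->.
have [|[p [p_pr p7 pm]]|m25|m3] := odd_large_prime om.
- by apply: contra m_notin; rewrite !inE => /or4P [] ->; rewrite ?orbT.
- exact: (odd_moebius_large_prime p_pr p7 pm om m7 wm km rel cd).
- exact: (odd_moebius_five m25 om wm km rel cd).
- exact: (odd_moebius_three m3 m9 om wm km rel cd).
Qed.

(** * Moebius relations between conjugate cosines: order divisible by 4 *)

(** The number y + 1/y is a rational algebraic integer of absolute value at most 2,
    that is, one of 0, 1, -1, 2, -2. *)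
Lemma rational_cosine (N : nat) (y : algC) (r : rat) :
  (0 < N)%N -> y ^+ N = 1 -> y + y^-1 = ratr r -> y ^+ 12 = 1.
Proof.
move=> N0 yN yr; have y1 : `|y| = 1.
  by apply/eqP; rewrite -(pexpr_eq1 N0) // -normrX yN normr1.
have y0 : y != 0 by rewrite -normr_eq0 y1 oner_neq0.
have yA : y \in Aint by apply: (Aint_unity_root N0); apply/unity_rootP.
have yVA : y^-1 \in Aint by apply: (Aint_unity_root N0); apply/unity_rootP; rewrite exprVn yN invr1.
have /intrP [t tE] : y + y^-1 \is a Num.int.
  by apply: Cint_rat_Aint; [rewrite yr; apply: Crat_rat | apply: rpredD].
have t2 : (`|t| <= 2)%N.
  have : `|y + y^-1| <= 2%:R.
    by apply: le_trans (ler_normD _ _) _; rewrite normfV y1 invr1.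
  by rewrite tE -intr_norm -[2%:R]/(2%:~R) ler_int lez_nat.
have yE : y ^+ 2 - t%:~R * y + 1 = 0 by rewrite -tE; field.
have fin (P : algC) : y ^+ 12 - 1 = P * (y ^+ 2 - t%:~R * y + 1) -> y ^+ 12 = 1.
  by rewrite yE mulr0 => /eqP; rewrite subr_eq0 => /eqP.
have : t \in [:: 0; 1; -1; 2; -2].
  by case: t t2 {tE yE fin} => [[|[|[|t]]]|[|[|t]]].
rewrite !inE => /or4P [/eqP t0|/eqP t0|/eqP t0|/orP [] /eqP t0];
  rewrite {}t0 in fin yE.
- apply: (fin (y ^+ 10 - y ^+ 8 + y ^+ 6 - y ^+ 4 + y ^+ 2 - 1)); ring.
- apply: (fin ((y + 1) * (y ^+ 3 - 1) * (y ^+ 6 + 1))); ring.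
- apply: (fin ((y - 1) * (y ^+ 3 + 1) * (y ^+ 6 + 1))); ring.
- have /eqP : (y - 1) ^+ 2 = 0 by rewrite -[RHS]yE; ring.
  by rewrite expf_eq0 /= subr_eq0 => /eqP ->; rewrite expr1n.
- have /eqP : (y + 1) ^+ 2 = 0 by rewrite -[RHS]yE; ring.
  by rewrite expf_eq0 /= addr_eq0 => /eqP ->; rewrite -signr_odd expr0.
Qed.

Lemma cosz_mul (F : fieldType) (w : F) (k : int) :
  w != 0 -> cosz w 1 * cosz w k = cosz w (k + 1) + cosz w (k - 1).
Proof.
move=> w0; rewrite /cosz !opprD !opprK !expfzDr //; ring.
Qed.

Lemma cosz_conj (N j : nat) (w : algC) :
    N.-primitive_root w -> coprime j N ->
  exists u : {rmorphism algC -> algC}, forall e, u (cosz w e) = cosz (w ^+ j) e.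
Proof.
move=> wN jN; have [u uE] := Qn_aut_exists jN; exists u => e.
have w0 := prim_root_neq0 wN.
rewrite /cosz rmorphD /= !rmorphXz ?unitfE //= uE //; exact: prim_expr_order.
Qed.

(** Add the relation and its image under s. *)
Lemma odd_involution_split (F : numFieldType) (s : {rmorphism F -> F}) (c d a b x y : F) :
    s c = c -> s d = d -> s a = a -> s b = b -> s x = - x -> s y = - y ->
  (c * x + d) * y = a * x + b -> c * (x * y) = b.
Proof.
move=> sc sd sa sb sx sy rel; have := congr1 s rel.
rewrite rmorphM !rmorphD !rmorphM /= sc sd sa sb sx sy => rel'.
have two0 : 2 != 0 :> F by rewrite pnatr_eq0.
apply: (mulfI two0).
have -> : 2 * (c * (x * y)) = (c * x + d) * y + (c * - x + d) * - y by ring.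
by rewrite rel rel'; ring.
Qed.

Lemma prim_root_half (m : nat) (w : algC) :
  (2 * m).-primitive_root w -> w ^+ m = -1.
Proof.
move=> wN; have m0 : (0 < m)%N by have := prim_order_gt0 wN; rewrite muln_gt0.
have : w ^+ m ^+ 2 = 1 ^+ 2 by rewrite -exprM mulnC (prim_expr_order wN) expr1n.
move/eqP; rewrite eqf_sqr => /orP [] /eqP // /eqP; rewrite -(prim_order_dvd wN).
by move=> /(dvdn_leq m0); lia.
Qed.

Lemma prim_root_opp (N : nat) (w : algC) : (4 %| N)%N -> N.-primitive_root w ->
  coprime (1 + N %/ 2) N /\ w ^+ (1 + N %/ 2) = - w.
Proof.
move=> N4 wN; have [u NE] := dvdnP N4.
have NE2 : (N %/ 2 = u * 2)%N by rewrite NE (mulnA u 2 2) mulnK.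
split.
  apply: (@coprime_dvdr _ ((u * 2) ^ 2)%N).
    by rewrite NE; apply/dvdnP; exists u; ring.
  by rewrite coprimeXr // NE2 coprime_sym /coprime addnC -{2}[(u * 2)%N]mul1n gcdnMDl gcdn1.
rewrite exprD expr1 NE2 prim_root_half ?mulrN1 //.
by rewrite (_ : 2 * (u * 2) = N)%N // NE; lia.
Qed.

Lemma cosz_opp_odd (w : algC) (e : int) : odd `|e| -> cosz (- w) e = - cosz w e.
Proof.
move=> oe; have N1 (f : int) : odd `|f| -> (- w) ^ f = - (w ^ f).
  move=> of_; rewrite -mulN1r expfzMl.
  have -> : (-1 : algC) ^ f = -1; last by rewrite mulN1r.
  case: f of_ => n on; first by rewrite -exprnP -signr_odd on.
  by rewrite NegzE -exprnN -signr_odd [odd _]on expr1 invrN1.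
by rewrite /cosz !N1 ?abszN // opprD.
Qed.

(** Apply the automorphism w -> - w, which negates both cosines as k is odd. *)
Lemma moebius_split (N : nat) (w : algC) (c d a b : rat) (k : int) :
    (4 %| N)%N -> N.-primitive_root w -> coprime `|k| N ->
    (ratr c * cosz w 1 + ratr d) * cosz w k = ratr a * cosz w 1 + ratr b ->
  ratr c * (cosz w 1 * cosz w k) = ratr b.
Proof.
move=> N4 wN kN rel; have [jN wj] := prim_root_opp N4 wN.
have [s sE] := cosz_conj wN jN.
have ok : odd `|k|.
  by rewrite -coprimen2; apply: coprime_dvdr kN; apply: dvdn_trans N4.
by apply: (odd_involution_split (s := s)) rel;
  rewrite ?fmorph_rat ?sE ?wj ?cosz_opp_odd.
Qed.

Definition product_rel (r : rat) (k : int) : seq (rat * int) :=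
  [:: (1, k + 1); (1, - (k + 1)); (1, k - 1); (1, - (k - 1)); (- r, 0)].

Lemma class_sum_product (F : numFieldType) p (x : F) r k (i : 'F_p) :
  class_sum x (product_rel r k) i =
    (k%:~R + 1 == i)%:R * x ^ (k + 1) + (- (k%:~R + 1) == i)%:R * x ^ (- (k + 1)) +
    (k%:~R - 1 == i)%:R * x ^ (k - 1) + (- (k%:~R - 1) == i)%:R * x ^ (- (k - 1)) -
    (0 == i)%:R * ratr r.
Proof.
rewrite /class_sum big_mkcond !big_cons big_nil /= !rmorphN /= !rmorphD !rmorphN /=.
have ifE (t : bool) (u : F) : (if t then u else 0) = t%:R * u.
  by case: t; rewrite ?mul1r ?mul0r.
rewrite !ifE expr0z !mulr1z !mulr0z rmorph1; ring.
Qed.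

Lemma product_relE (w : algC) (r : rat) (k : int) : w != 0 ->
  cosz w 1 * cosz w k = ratr r ->
  \sum_(e <- product_rel r k) ratr e.1 * w ^ e.2 = 0.
Proof.
move=> w0; rewrite cosz_mul // => prod; rewrite !big_cons big_nil /= rmorphN /= -prod.
rewrite rmorph1 /cosz expr0z; ring.
Qed.

(** The exponent k + 1 is alone in its class. *)
Lemma class_sum_product_neq0 p (x : algC) r k :
    prime p -> (3 <= p)%N -> x != 0 -> k%:~R != 0 :> 'F_p -> k%:~R + 1 != 0 :> 'F_p ->
  ~ (forall i : 'F_p, class_sum x (product_rel r k) i = 0).
Proof.
move=> p_pr p3 x0; set q : 'F_p := k%:~R => q0 q1 CS.
have n2 : 2%:R != 0 :> 'F_p by apply: natFp_neq0.
have n2q : 2 * q != 0 by rewrite mulf_neq0.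
have n2q1 : 2 * (q + 1) != 0 by rewrite mulf_neq0.
have := CS (q + 1); rewrite class_sum_product -/q; Fp_decide.
by rewrite !bool_simp => /eqP; rewrite (negbTE (expfz_neq0 _ x0)).
Qed.

(** The product is a sum of four powers of w, too few to fill the classes modulo a
    prime p >= 7; modulo 5 they can fill them, but then all four powers are equal,
    and the remaining orders are divisible by 9. *)
Lemma product_irrational_odd (N : nat) (w : algC) (r : rat) (k : int) :
    (4 %| N)%N -> odd (N %/ 4) -> N \notin [:: 4; 12]%N ->
    N.-primitive_root w -> coprime `|k| N ->
  cosz w 1 * cosz w k <> ratr r.
Proof.
move=> N4 oN N_notin wN kN prod; have w0 := prim_root_neq0 wN.
have NE : N = (N %/ 4 * 4)%N by rewrite divnK.
have uN : (N %/ 4 %| N)%N by rewrite {2}NE dvdn_mulr.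
have sgn (P : int -> Prop) : P k \/ P (- k) ->
    exists k' : int, [/\ P k', `|k'|%N = `|k|%N & cosz w 1 * cosz w k' = ratr r].
  by case=> Pk; [exists k | exists (- k); rewrite abszN coszN].
have sgn_p (p : nat) : prime p -> (3 <= p)%N -> (p %| N)%N -> exists k' : int,
    [/\ k'%:~R != 0 :> 'F_p, k'%:~R + 1 != 0 :> 'F_p & cosz w 1 * cosz w k' = ratr r].
  move=> p_pr p3 pN; have k0 := int_Fp_neq0 p_pr (coprime_dvdr pN kN).
  have [|k' [[k'0 k'1] _ prod']] :=
    sgn (fun k => k%:~R != 0 :> 'F_p /\ k%:~R + 1 != 0 :> 'F_p); last by exists k'.
  have [e|e] := eqVneq (k%:~R + 1 : 'F_p) 0; [right|by left].
  have n2 : 2%:R != 0 :> 'F_p by apply: natFp_neq0.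
  rewrite rmorphN oppr_eq0 /=; split=> //.
  have -> : - k%:~R + 1 = 2%:R - (k%:~R + 1) :> 'F_p by ring.
  by rewrite e subr0.
have [[p [p_pr p7 pu]]|N5|N9] : [\/ exists p, [/\ prime p, (7 <= p)%N & (p %| N %/ 4)%N],
     (5 %| N)%N | (3 * 3 %| N)%N].
  have [|u_notin] := boolP ((N %/ 4)%N \in [:: 1; 3; 5; 15]%N).
    rewrite !inE => /or4P [] /eqP u.
    - by rewrite NE u in N_notin.
    - by rewrite NE u in N_notin.
    - by constructor 2; rewrite NE u.
    - by constructor 2; rewrite NE u.
  case: (odd_large_prime oN u_notin) => [|u5|u3]; first by constructor 1.
  - by constructor 2; apply: dvdn_trans (dvdn_trans u5 uN).
  - by constructor 3; apply: dvdn_trans u3 uN.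
- have pN := dvdn_trans pu uN; have p3 : (3 <= p)%N by apply: leq_trans p7.
  have [k' [k'0 k'1 prod']] := sgn_p p p_pr p3 pN.
  have [M [x [S [_ _ xM CS]]]] := class_sum_prime p_pr pN wN (product_relE w0 prod').
  have p5 : (size (product_rel r k') < p)%N by apply: leq_trans p7.
  have S0 := class_sum_missing p_pr p5 CS; rewrite {}S0 in CS.
  exact: (class_sum_product_neq0 p_pr p3 (prim_root_neq0 xM) k'0 k'1 CS).
- have k5 := coprime_dvdr N5 kN.
  have [|k' [k'P _ prod']] := sgn (fun k => k%:~R = 1 :> 'F_5 \/ k%:~R = 2 :> 'F_5).
    have := int_Fp_neq0 (isT : prime 5) k5; rewrite rmorphN /=.
    move: (k%:~R : 'F_5) => q.
    case: q => [[|[|[|[|[|q]]]]] //= qlt] //= _.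
    + by left; left; apply/val_inj.
    + by left; right; apply/val_inj.
    + by right; right; apply/val_inj.
    + by right; left; apply/val_inj.
  have [M [x [S [_ NM xM CS]]]] :=
    class_sum_prime (isT : prime 5) N5 wN (product_relE w0 prod').
  have x0 := prim_root_neq0 xM; case: k'P => k'E.
    have S0 : S = 0.
      by rewrite -(CS 1) class_sum_product k'E; Fp_compute; rewrite !bool_simp.
    have := CS 2; rewrite S0 class_sum_product k'E; Fp_compute.
    by rewrite !bool_simp => /eqP; rewrite (negbTE (expfz_neq0 _ x0)).
  have xS3 : x ^ (k' + 1) = S.
    by rewrite -(CS 3) class_sum_product k'E; Fp_compute; rewrite !bool_simp.
  have xS1 : x ^ (k' - 1) = S.
    by rewrite -(CS 1) class_sum_product k'E; Fp_compute; rewrite !bool_simp.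
  have : x ^ ((k' + 1) - (k' - 1)) == 1.
    by rewrite expfzDr // xS3 -xS1 -invr_expz mulfV ?expfz_neq0.
  have -> : (k' + 1) - (k' - 1) = 2 :> int by ring.
  rewrite (prim_root_exprz_eq1 _ xM) /= => M2.
  have M4 : (4 %| M)%N.
    by rewrite -(@Gauss_dvdr 4 5) //; apply: dvdn_trans NM.
  by have := dvdn_trans M4 M2.
have [|k' [k'0 k'1 prod']] := sgn_p 3%N isT isT; first exact: dvdn_trans N9.
apply: (class_sum_product_neq0 (isT : prime 3) isT w0 k'0 k'1).
exact: (class_sum_sq _ N9 wN (product_relE w0 prod')).
Qed.

(** The product is the sum of 2 cos((k + 1) t) and 2 cos((k - 1) t). Multiplying w
    by a fourth root of unity i negates the one whose multiplier is 2 mod 4, which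
    is therefore 0, and the other one is a rational cosine. *)
Lemma product_irrational_eight (N : nat) (w : algC) (r : rat) (k : int) :
    (8 %| N)%N -> N \notin [:: 8; 24]%N -> N.-primitive_root w -> coprime `|k| N ->
  cosz w 1 * cosz w k <> ratr r.
Proof.
move=> N8 N_notin wN kN; have w0 := prim_root_neq0 wN.
have [u NE] := dvdnP N8; have N0 := prim_order_gt0 wN.
have NE4 : (N %/ 4 = u * 2)%N by rewrite NE (mulnA u 2 4) mulnK.
have jN : coprime (1 + N %/ 4) N.
  apply: (@coprime_dvdr _ ((u * 2) ^ 3)%N).
    by rewrite NE; apply/dvdnP; exists (u ^ 2)%N; ring.
  by rewrite coprimeXr // NE4 coprime_sym /coprime addnC -{2}[(u * 2)%N]mul1n gcdnMDl gcdn1.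
set i := w ^+ (N %/ 4).
have i2 : i ^+ 2 = -1.
  have : (i ^+ 2) ^+ 2 = 1 ^+ 2.
    rewrite -exprM /i -exprM -[(2 * 2)%N]/4%N divnK ?expr1n ?prim_expr_order //.
    exact: dvdn_trans N8.
  move/eqP; rewrite eqf_sqr => /orP [] /eqP // /eqP.
  rewrite -exprM -(prim_order_dvd wN) NE4 => /dvdn_leq; rewrite NE.
  by move: N0; rewrite NE; lia.
have i0 : i != 0 by rewrite expf_neq0.
have [s sE] := cosz_conj wN jN.
have wj : w ^+ (1 + N %/ 4) = w * i by rewrite exprD expr1.
have ok : odd `|k|.
  by rewrite -coprimen2; apply: coprime_dvdr kN; apply: dvdn_trans N8.
have i4 : i ^ 4%:Z = 1 by rewrite -exprnP (exprM i 2 2) i2 sqrrN expr1n.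
have cosz0 (e : int) : cosz (w * i) (e * 4) = cosz w (e * 4).
  have i4e (f : int) : i ^ (f * 4) = 1 by rewrite mulrC -exprz_exp i4 exp1rz.
  by rewrite /cosz !expfzMl -[i ^ (- _)]invr_expz i4e invr1 !mulr1.
have cosz2 (e : int) : cosz (w * i) (e * 4 + 2) = - cosz w (e * 4 + 2).
  have i4e (f : int) : i ^ (f * 4) = 1 by rewrite mulrC -exprz_exp i4 exp1rz.
  have i2e : i ^ (e * 4 + 2) = -1 by rewrite expfzDr // i4e mul1r.
  by rewrite /cosz !expfzMl -[i ^ (- _)]invr_expz i2e invrN1 !mulrN1 -opprD.
(* replacing k by - k, assume k + 1 = 2 mod 4 *)
wlog [e kE] : k kN ok / exists e : int, k + 1 = e * 4 + 2.
  move=> IH; have [e [kE|kE]] : exists e : int, k + 1 = e * 4 + 2 \/ - k + 1 = e * 4 + 2.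
    have : (k = 1 %[mod 4])%Z \/ (k = 3 %[mod 4])%Z by lia.
    by case=> k4; [exists (k %/ 4)%Z; left | exists (- (k %/ 4)%Z - 1); right]; lia.
  - by apply: IH => //; exists e.
  - by rewrite -(coszN w k); apply: IH; rewrite ?abszN //; exists e.
have kE' : k - 1 = e * 4 by lia.
rewrite cosz_mul // kE kE' => prod.
have c2 : cosz w (e * 4 + 2) = 0.
  have := congr1 s prod; rewrite fmorph_rat -prod rmorphD /= !sE wj cosz0 cosz2.
  move/addIr/eqP; rewrite eq_sym -addr_eq0 -mulr2n mulrn_eq0 /= => /eqP //.
rewrite c2 add0r in prod; set y := w ^ (e * 4) in prod.
have y0 : y != 0 by rewrite expfz_neq0.
have y12 : y ^+ 12 = 1.
  apply: (rational_cosine (r := r) N0); last by rewrite -prod /cosz /y invr_expz.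
  by rewrite /y exprnP exprzAC -exprnP (prim_expr_order wN) exp1rz.
have y2 : y ^+ 2 * w ^+ 4 = -1.
  have wE : w ^ (e * 4 + 2) = y * w ^+ 2 by rewrite expfzDr.
  move/eqP: c2; rewrite /cosz -invr_expz wE addr_eq0 => /eqP /(congr1 (fun z => z * (y * w ^+ 2))).
  rewrite mulNr mulVf ?mulf_neq0 ?expf_neq0 // => <-; ring.
have : w ^+ 24 == 1.
  have -> : w ^+ 24 = (y ^+ 2 * w ^+ 4) ^+ 6 / y ^+ 12 by field.
  by rewrite y2 y12 divr1 -signr_odd expr0.
rewrite -(prim_order_dvd wN) => N24.
have /allP /(_ N) : all (fun s => (8 %| s)%N && (s %| 24)%N ==>
  (s \in [:: 8; 24]%N)) (iota 0 25) by [].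
by rewrite mem_iota N8 N24 (negbTE N_notin) /= ltnS (dvdn_leq _ N24) // => /(_ isT).
Qed.

(** Once the relation is split, a nonzero c would make the product of the two
    cosines rational. This does occur for order 24, where 2 cos(t) 2 cos(5 t) = 1
    with t = pi/12. *)
Lemma four_moebius (N : nat) (w : algC) (c d a b : rat) (k : int) :
    (4 %| N)%N -> N \notin [:: 4; 8; 12; 24]%N ->
    N.-primitive_root w -> coprime `|k| N ->
    (ratr c * cosz w 1 + ratr d) * cosz w k = ratr a * cosz w 1 + ratr b ->
  c = 0 /\ b = 0.
Proof.
move=> N4 N_notin wN kN /(moebius_split N4 wN kN) prod.
have [c0|c0] := eqVneq c 0.
  by split=> //; apply/eqP; rewrite -ratr_eq0 -prod c0 rmorph0 mul0r.
have {}prod : cosz w 1 * cosz w k = ratr (c^-1 * b).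
  by rewrite rmorphM fmorphV /= -prod mulKf // ratr_eq0.
have [N8|N8] := boolP (8 %| N)%N.
  case: (product_irrational_eight N8 _ wN kN prod).
  by apply: contra N_notin; rewrite !inE => /orP [] ->; rewrite ?orbT.
case: (product_irrational_odd N4 _ _ wN kN prod).
  by apply: contraR N8 => oN; rewrite -(divnK N4) -[8%N]/(2 * 4)%N dvdn_pmul2r // dvdn2.
by apply: contra N_notin; rewrite !inE => /orP [] ->; rewrite ?orbT.
Qed.

(** * The minimal polynomial of w + 1/w *)

Lemma totient_split (p n : nat) : prime p -> (p %| n)%N -> (0 < n)%N ->
  exists m, [/\ coprime p m, n = (m * p ^ logn p n)%N, (0 < logn p n)%N &
    totient n = (totient m * (p.-1 * p ^ (logn p n).-1))%N].
Proof.
move=> p_pr pn n0; have [m pm nE] := pfactor_coprime p_pr n0.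
have l0 : (0 < logn p n)%N by rewrite logn_gt0 mem_primes p_pr n0.
exists m; split=> //; rewrite {1}nE totient_coprime ?totient_pfactor //.
by rewrite coprime_sym coprimeXl.
Qed.

Lemma even_totient (N : nat) : (2 < N)%N -> ~~ odd (totient N).
Proof.
have odd_p (p n : nat) : prime p -> (p %| n)%N -> (0 < n)%N -> odd (totient n) -> p = 2%N.
  move=> p_pr pn n0; have [m [_ _ _ ->]] := totient_split p_pr pn n0.
  rewrite !oddM => /and3P [_ op _]; case: (even_prime p_pr) => // p_odd.
  by case: (p) op p_odd => //= q ->.
move=> N2; apply/negP => oN; have N0 : (0 < N)%N by apply: leq_trans N2.
have p_pr : prime (pdiv N) by apply: pdiv_prime; apply: leq_trans N2.
have p2 := odd_p _ _ p_pr (pdiv_dvd N) N0 oN; rewrite p2 in p_pr.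
have N_2 : (2 %| N)%N by rewrite -p2 pdiv_dvd.
have [m [m2 NE l0 tE]] := totient_split (isT : prime 2) N_2 N0.
move: oN; rewrite tE !oddM => /and3P [om _].
case: (logn 2 N) l0 NE => [//|[|l]] _ NE; last by rewrite /= oddX.
have m1 : (1 < m)%N by rewrite NE expn1 in N2; lia.
have := odd_p _ _ (pdiv_prime m1) (pdiv_dvd m) (ltnW m1) om => q2.
by move: m2; rewrite coprime2n => om' _; have := pdiv_dvd m; rewrite q2 dvdn2 om'.
Qed.

(** Pair k with N - k. *)
Lemma sum_totatives (N : nat) : (1 < N)%N ->
  (2 * \sum_(1 <= k < N | coprime k N) k = N * totient N)%N.
Proof.
move=> N1; have N0 : (0 < N)%N by apply: ltnW.
have totE : totient N = (\sum_(1 <= k < N | coprime k N) 1)%N.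
  rewrite totient_count_coprime (big_ltn N0) [in RHS]big_mkcond /=.
  have -> : coprime N 0 = false by rewrite /coprime gcdn0; case: (N) N1 => [|[]].
  by rewrite add0n; apply: eq_bigr => k _; rewrite coprime_sym; case: coprime.
have copB (k : nat) : (k <= N)%N -> coprime (N - k) N = coprime k N.
  by move=> kN; rewrite /coprime -{2 3}(subnK kN) gcdnDl gcdnDr gcdnC.
have rev : (\sum_(1 <= k < N | coprime k N) k = \sum_(1 <= k < N | coprime k N) (N - k))%N.
  rewrite big_nat_rev /= big_nat_cond [RHS]big_nat_cond; apply: eq_big => k.
    case: (ltnP 0 k) => //= k0; case: (ltnP k N) => //= kN.
    by rewrite add1n subSS copB // ltnW.
  by move=> _; rewrite add1n subSS.
rewrite mul2n -addnn {1}rev -big_split /= totE big_distrr /= big_nat_cond [RHS]big_nat_cond.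
by apply: eq_bigr => k /andP [/andP [_ kN] _]; rewrite muln1 subnK // ltnW.
Qed.

(** The polynomials with T_e(x + 1/x) = x^e + x^-e. *)
Fixpoint dickson (e : nat) : {poly rat} :=
  match e with
  | 0%N => 2%:P
  | e'.+1 => match e' with 0%N => 'X | e''.+1 => 'X * dickson e' - dickson e'' end
  end.

Lemma dickson_cosz (w : algC) (e : nat) : w != 0 ->
  (map_poly ratr (dickson e)).[cosz w 1] = cosz w e.
Proof.
move=> w0; have: (map_poly ratr (dickson e)).[cosz w 1] = cosz w e /\
   (map_poly ratr (dickson e.+1)).[cosz w 1] = cosz w e.+1; last by case.
elim: e => [|e [IH1 IH2]]; split=> //.
- by rewrite /= map_polyC hornerC /= rmorph_nat /cosz !expr0z.
- by rewrite /= map_polyX hornerX.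
have -> : dickson e.+2 = 'X * dickson e.+1 - dickson e by [].
rewrite rmorphB rmorphM /= map_polyX !hornerE IH1 IH2 cosz_mul //.
have -> : e.+1%:Z + 1 = e.+2 by lia.
by have -> : e.+1%:Z - 1 = e; [lia | rewrite addrK].
Qed.

Lemma size_dickson (e : nat) : (size (dickson e) <= e.+1)%N.
Proof.
suff: (size (dickson e) <= e.+1)%N /\ (size (dickson e.+1) <= e.+2)%N by case.
elim: e => [|e [IH1 IH2]]; split=> //.
- by rewrite /= size_polyC.
- by rewrite /= size_polyX.
have -> : dickson e.+2 = 'X * dickson e.+1 - dickson e by [].
apply: leq_trans (size_polyD _ _) _; rewrite geq_max size_polyN.
rewrite (leq_trans IH1) ?andbT; last by rewrite ltnS ltnW.
have [->|d0] := eqVneq (dickson e.+1) 0; first by rewrite mulr0 size_poly0.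
by rewrite mulrC size_mulX.
Qed.

Lemma dickson_lead (e : nat) : (0 < e)%N -> (dickson e)`_e = 1.
Proof.
case: e => // e _; elim: e => [|e IH]; first by rewrite /= coefX.
have -> : dickson e.+2 = 'X * dickson e.+1 - dickson e by [].
by rewrite coefB coefXM /= IH (nth_default _ (leq_trans (size_dickson _) _)) ?subr0.
Qed.

(** The product of the primitive roots of unity is w to the sum of the totatives,
    a multiple of N. *)
Lemma Cyclotomic_coef0 (N : nat) : (2 < N)%N -> ('Phi_N)`_0 = 1.
Proof.
move=> N2; have N0 : (0 < N)%N by apply: leq_trans N2.
have [w wN] := C_prim_root_exists N0.
apply: (intr_inj (R := algC)); rewrite -coef_map /= (Cintr_Cyclotomic wN).
rewrite -horner_coef0 /cyclotomic horner_prod.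
under eq_bigr do rewrite hornerXsubC sub0r.
under eq_bigr do rewrite -mulN1r.
rewrite big_split /= prodr_const.
have -> : #|[pred k : 'I_N | coprime k N]| = totient N.
  rewrite totient_count_coprime big_mkord -sum1_card big_mkcond /=.
  by apply: eq_bigr => k _; rewrite inE coprime_sym; case: coprime.
rewrite -signr_odd (negbTE (even_totient N2)) expr0 mul1r prodrXr.
have tE : (totient N = 2 * (totient N)./2)%N.
  by rewrite mul2n -[LHS]odd_double_half (negbTE (even_totient N2)).
have -> : (\sum_(k < N | coprime k N) k = N * (totient N)./2)%N.
  apply/eqP; rewrite -(eqn_pmul2l (isT : 0 < 2)%N) mulnCA -tE.
  rewrite -(sum_totatives (ltnW N2)) -(big_mkord (fun k => coprime k N) (fun k => k)).
  by rewrite [X in (_ * X)%N == _]big_ltn_cond //= add0n; case: ifP.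
by rewrite exprM (prim_expr_order wN) expr1n.
Qed.

Lemma prim_root_inv (N : nat) (w : algC) :
  N.-primitive_root w -> N.-primitive_root w^-1.
Proof.
move=> wN; have N0 := prim_order_gt0 wN.
have -> : w^-1 = w ^+ N.-1.
  apply: (mulfI (prim_root_neq0 wN)).
  by rewrite mulfV ?(prim_root_neq0 wN) // -exprS prednK // (prim_expr_order wN).
by rewrite prim_root_exp_coprime // coprimePn.
Qed.

Lemma cosz_abs (w : algC) (e : int) : cosz w `|e|%N = cosz w e.
Proof. by case: e => n //=; rewrite NegzE coszN. Qed.

(** Averaging w^-h Phi_N(w) over w and 1/w, with 2 h = deg Phi_N, gives a
    polynomial of degree h in w + 1/w. *)
Lemma cosz_annihilator (N : nat) (w : algC) :
    (2 < N)%N -> N.-primitive_root w ->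
  exists g : {poly rat}, [/\ g != 0, (size g <= (totient N)./2.+1)%N &
    root (map_poly ratr g) (cosz w 1)].
Proof.
move=> N2 wN; have w0 := prim_root_neq0 wN; set h := (totient N)./2.
have hE : totient N = (2 * h)%N.
  by rewrite mul2n -[LHS]odd_double_half (negbTE (even_totient N2)).
have h0 : (0 < h)%N.
  by have := totient_gt0 N; rewrite hE muln_gt0 /= => ->; apply: leq_trans N2.
pose P : {poly int} := 'Phi_N.
have Pw (x : algC) : N.-primitive_root x ->
    \sum_(i < (2 * h).+1) (P`_i)%:~R * x ^+ i = 0.
  move=> xN; have : (cyclotomic w N).[x] = 0 by apply/rootP; rewrite (root_cyclotomic wN).
  rewrite -(Cintr_Cyclotomic wN) horner_coef size_map_inj_poly //; last exact: intr_inj.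
  rewrite size_Cyclotomic hE => P0; rewrite -[RHS]P0.
  by apply: eq_bigr => i _; rewrite coef_map.
pose g := \sum_(i < (2 * h).+1) (P`_i)%:~R *: dickson `|i%:Z - h%:Z|%N.
have abs_le (i : 'I_(2 * h).+1) : (`|i%:Z - h%:Z| <= h)%N by case: i => i /= ilt; lia.
exists g; split.
- apply/eqP => /(congr1 (fun q : {poly rat} => q`_h)); rewrite coef0 coef_sum.
  have max0 : ord_max != ord0 :> 'I_(2 * h).+1 by rewrite -val_eqE /=; lia.
  rewrite (bigD1 ord0) // (bigD1 ord_max) //= !coefZ.
  rewrite (_ : `|0%:Z - h%:Z|%N = h) ?dickson_lead //; last by lia.
  rewrite (_ : `|(2 * h)%N%:Z - h%:Z|%N = h) ?dickson_lead //; last by lia.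
  rewrite big1 ?addr0; last first.
    move=> [i ilt]; rewrite -!val_eqE /= => i0; rewrite coefZ [X in _ * X]nth_default ?mulr0 //.
    by apply: leq_trans (size_dickson _) _; lia.
  rewrite /P Cyclotomic_coef0 //.
  have := Cyclotomic_monic N; rewrite monicE lead_coefE size_Cyclotomic hE /= => /eqP ->.
  by [].
- apply: leq_trans (size_sum _ _ _) _; apply/bigmax_leqP => i _.
  apply: leq_trans (size_scale_leq _ _) _; apply: leq_trans (size_dickson _) _.
  by rewrite ltnS abs_le.
apply/rootP; rewrite /g rmorph_sum /= horner_sum.
transitivity (w ^- h * (\sum_(i < (2 * h).+1) (P`_i)%:~R * w ^+ i) +
              w ^+ h * (\sum_(i < (2 * h).+1) (P`_i)%:~R * w^-1 ^+ i)); last first.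
  by rewrite !Pw ?prim_root_inv // !mulr0 addr0.
rewrite !mulr_sumr -big_split; apply: eq_bigr => i _ /=.
rewrite map_polyZ hornerZ dickson_cosz // rmorph_int.
rewrite cosz_abs /cosz opprB !expfzDr // -!exprnP -!exprnN exprVn; ring.
Qed.

Definition minpoly_algC (t : algC) (p : {poly rat}) : Prop :=
  p \is monic /\ forall q : {poly rat}, root (map_poly ratr q) t = (p %| q).

Lemma minpoly_algC_root t p : minpoly_algC t p -> root (map_poly ratr p) t.
Proof. by case=> _ ->. Qed.

Lemma recip_sum_root (r : algC) : exists2 x : algC, x != 0 & r = x + x^-1.
Proof.
have [x xE] : exists x : algC, x ^+ 2 - r * x + 1 = 0.
  have two0 : 2 != 0 :> algC by rewrite pnatr_eq0.
  exists ((r + sqrtC (r ^+ 2 - 4)) / 2).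
  have sE := sqrtCK (r ^+ 2 - 4).
  have -> : ((r + sqrtC (r ^+ 2 - 4)) / 2) ^+ 2 - r * ((r + sqrtC (r ^+ 2 - 4)) / 2) + 1
     = (sqrtC (r ^+ 2 - 4) ^+ 2 - (r ^+ 2 - 4)) / 4 by field.
  by rewrite sE subrr mul0r.
have x0 : x != 0.
  apply: contra_eq_neq xE => ->; rewrite expr0n mulr0 subr0 add0r; exact: oner_neq0.
exists x => //; apply: (mulIf x0); rewrite mulrDl mulVf //.
by apply/eqP; rewrite eq_sym -subr_eq0 -[X in _ == X]xE; apply/eqP; ring.
Qed.

Lemma cosz_conj_root (N k : nat) (w : algC) (p : {poly rat}) :
    N.-primitive_root w -> coprime k N ->
  root (map_poly ratr p) (cosz w 1) -> root (map_poly ratr p) (cosz (w ^+ k) 1).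
Proof.
move=> wN kN; have [u uE] := cosz_conj wN kN; rewrite -uE => /(rmorph_root u).
rewrite -map_poly_comp; congr (root _ _); apply: eq_map_poly => a.
exact: fmorph_rat.
Qed.

(** Over algC, the minimal polynomial p of w + 1/w turns into the product of the
    X^2 - r X + 1 over its roots r, which is divisible by Phi_N; the degree bound
    of the annihilator makes them equal, so that each r is conjugate. *)
Lemma cosz_minpoly (N : nat) (w : algC) (p : {poly rat}) :
    (2 < N)%N -> N.-primitive_root w -> minpoly_algC (cosz w 1) p ->
  ((size p).-1 * 2 = totient N)%N /\
  forall z, root (map_poly ratr p) z ->
    exists2 k : nat, coprime k N & z = cosz w k.
Proof.
move=> N2 wN tp; have [p_monic pP] := tp; have w0 := prim_root_neq0 wN.
have p_root := minpoly_algC_root tp.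
have [g [g0 g_size g_root]] := cosz_annihilator N2 wN.
have p_size : (size p <= (totient N)./2.+1)%N.
  by apply: leq_trans g_size; apply: dvdp_leq; rewrite // -pP.
have [rs pE] := closed_field_poly_normal (map_poly ratr p : {poly algC}).
have lead1 : lead_coef (map_poly ratr p : {poly algC}) = 1.
  by rewrite lead_coef_map (monicP p_monic) rmorph1.
rewrite lead1 scale1r in pE.
have rs_size : size rs = (size p).-1.
  by rewrite -(size_map_poly (ratr : rat -> algC) p) pE size_prod_XsubC.
pose L : {poly algC} := \prod_(r <- rs) ('X^2 - r *: 'X + 1).
have quad_size (r : algC) : size ('X^2 - r *: 'X + 1) = 3%N.
  rewrite -addrA size_polyDl ?size_polyXn //.
  apply: leq_ltn_trans (size_polyD _ _) _.
  rewrite size_polyN size_poly1 gtn_max /= andbT ltnS.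
  by apply: leq_trans (size_scale_leq _ _) _; rewrite size_polyX.
have L_size : size L = ((size p).-1 * 2).+1.
  rewrite /L size_prod_seq; last by move=> r _; rewrite -size_poly_eq0 quad_size.
  under eq_bigr do rewrite quad_size.
  by rewrite big_const_seq count_predT iter_addn_0 rs_size; lia.
have Lx (x : algC) : x != 0 -> L.[x] = x ^+ size rs * (map_poly ratr p).[cosz x 1].
  move=> x0; rewrite /L pE; elim: (rs) => [|r s IH].
    by rewrite !big_nil !hornerE.
  have quadE : ('X^2 - r *: 'X + 1).[x] = x * (cosz x 1 - r).
    by rewrite !hornerE /cosz expr1z exprN1; field.
  rewrite !big_cons !hornerM IH quadE hornerXsubC [size (r :: s)]/= exprS; exact: mulrACA.
have Phi_L : cyclotomic w N %| L.
  rewrite /cyclotomic -big_filter -(big_map (fun k : 'I_N => w ^+ k) predT (fun z => 'X - z%:P)).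
  apply: uniq_roots_dvdp.
    apply/allP => z /mapP [k]; rewrite mem_filter => /andP [kN _] ->.
    rewrite /root Lx ?expf_neq0 // mulf_eq0 expf_eq0 (negbTE (expf_neq0 k w0)) andbF /=.
    exact: (cosz_conj_root wN kN).
  rewrite uniq_rootsE map_inj_in_uniq ?filter_uniq ?index_enum_uniq //.
  move=> i j _ _ /eqP; rewrite (eq_prim_root_expr wN) !modn_small //.
  by move=> /eqP ij; apply: val_inj.
have L_eq : cyclotomic w N %= L.
  rewrite -dvdp_size_eqp // size_cyclotomic L_size.
  have := dvdp_leq _ Phi_L; rewrite -size_poly_eq0 L_size size_cyclotomic => /(_ isT).
  have := odd_double_half (totient N); rewrite (negbTE (even_totient N2)).
  by rewrite ltnS eqn_leq; lia.
split.
  by move: L_eq; rewrite -dvdp_size_eqp // size_cyclotomic L_size => /eqP [].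
move=> z; rewrite pE root_prod_XsubC => z_rs.
have [x x0 zE] := recip_sum_root z.
have Lx0 : root L x.
  rewrite /root Lx // mulf_eq0; apply/orP; right.
  by rewrite pE /cosz -exprnP expr1 exprN1 -zE -/(root _ _) root_prod_XsubC.
have : root (cyclotomic w N) x by rewrite (eqp_root L_eq).
rewrite (root_cyclotomic wN) => xN.
have [[k kN] /= xE] := prim_rootP wN (prim_expr_order xN).
by exists k; [rewrite -(prim_root_exp_coprime _ wN) -xE | rewrite zE /cosz -exprnP -exprnN -xE].
Qed.

(** * From real sines to roots of unity *)

Lemma Cyclotomic_root (F : numFieldType) (N : nat) (w : F) :
  N.-primitive_root w -> root (map_poly intr 'Phi_N) w.
Proof.
move=> wN; have N0 := prim_order_gt0 wN.
have dvd_root (d : nat) : (0 < d)%N -> root (map_poly intr 'Phi_d) w -> w ^+ d = 1.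
  move=> d0 /rootP wd; have := prod_Cyclotomic d0.
  rewrite (big_rem d) /=; last by rewrite -dvdn_divisors.
  move/(congr1 (fun q : {poly int} => (map_poly intr q : {poly F}).[w])).
  rewrite /= rmorphM rmorphB rmorph1 /= map_polyXn hornerM wd mul0r !hornerE.
  by move/esym/eqP; rewrite subr_eq0 => /eqP.
have := congr1 (fun q : {poly int} => (map_poly intr q : {poly F}).[w]) (prod_Cyclotomic N0).
rewrite /= rmorphB rmorph1 rmorph_prod /= map_polyXn horner_prod !hornerE.
rewrite (prim_expr_order wN) subrr => /eqP; rewrite prodf_seq_eq0 => /hasP [d].
rewrite -dvdn_divisors // => dN wd; have d0 : (0 < d)%N by apply: dvdn_gt0 dN.
have := dvd_root d d0 wd => /eqP; rewrite -(prim_order_dvd wN) => Nd.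
by rewrite (_ : N = d) //; apply/eqP; rewrite eqn_dvd Nd dN.
Qed.

(** Irreducibility of Phi_N, available over algC, is a statement on rational
    polynomials: it holds for primitive roots in every field. *)
Lemma prim_root_minpoly (F : numFieldType) (N : nat) (w : F) (f : {poly rat}) :
    N.-primitive_root w ->
  root (map_poly ratr f) w = (map_poly intr 'Phi_N %| f).
Proof.
move=> wN; set P : {poly rat} := map_poly intr 'Phi_N.
have PE (K : numFieldType) : map_poly ratr P = map_poly intr 'Phi_N :> {poly K}.
  by rewrite -map_poly_comp; apply: eq_map_poly => a; rewrite /= ratr_int.
have Pdvd (x : algC) (g : {poly rat}) : N.-primitive_root x ->
    root (map_poly ratr g) x = (P %| g).
  move=> xN; have [p [pE _] ->] := minCpolyP x.
  suff -> : p = P by [].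
  apply: (map_poly_inj (ratr : {rmorphism rat -> algC})).
  by rewrite /= -pE (minCpoly_cyclotomic xN) -(Cintr_Cyclotomic xN) PE.
have Pw : root (map_poly ratr P) w by rewrite PE Cyclotomic_root.
apply/idP/idP => [fw|/dvdpP [g ->]]; last by rewrite rmorphM rootM Pw orbT.
have gw : root (map_poly ratr (gcdp P f)) w by rewrite gcdp_map root_gcd Pw fw.
have g_size : size (map_poly ratr (gcdp P f) : {poly algC}) != 1%N.
  rewrite size_map_poly; apply: contraL gw => /size_poly1P [c c0 ->].
  by rewrite map_polyC rootC fmorph_eq0.
have [x gx] := closed_rootP _ g_size.
have [x0 x0N] := C_prim_root_exists (prim_order_gt0 wN).
have xN : N.-primitive_root x.
  rewrite -(root_cyclotomic x0N) -(Cintr_Cyclotomic x0N) -PE.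
  by move: gx; rewrite gcdp_map root_gcd => /andP [].
by move: gx; rewrite (Pdvd x) // => /dvdp_trans; apply; apply: dvdp_gcdr.
Qed.

(** x^deg(q) q(x + 1/x) as a polynomial in x. *)
Definition recip_lift (q : {poly rat}) : {poly rat} :=
  \sum_(i < size q) q`_i *: (('X^2 + 1) ^+ i * 'X^((size q).-1 - i)).

Lemma recip_liftE (F : numFieldType) (q : {poly rat}) (x : F) : x != 0 ->
  (map_poly ratr (recip_lift q)).[x] = x ^+ (size q).-1 * (map_poly ratr q).[cosz x 1].
Proof.
move=> x0; rewrite /recip_lift rmorph_sum /= horner_sum.
rewrite horner_coef size_map_poly mulr_sumr; apply: eq_bigr => i _.
rewrite map_polyZ hornerZ rmorphM rmorphXn rmorphD rmorph1 /= !map_polyXn.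
rewrite coef_map hornerM horner_exp hornerD !hornerXn hornerC /cosz expr1z exprN1.
rewrite [RHS]mulrCA; congr (_ * _).
have -> : x + x^-1 = (x ^+ 2 + 1) / x by field.
have i_le : (i <= (size q).-1)%N by case: i => i /=; lia.
rewrite (_ : x ^+ (size q).-1 = x ^+ ((size q).-1 - i) * x ^+ i); last by rewrite -exprD subnK.
by rewrite expr_div_n; field; rewrite expf_neq0.
Qed.

(** In both fields the vanishing amounts to Phi_N dividing the lift of q. This
    carries the minimal polynomial of a real number over to algC. *)
Lemma cosz_root_transfer (F : numFieldType) (N : nat) (w : F) (w' : algC) (q : {poly rat}) :
    N.-primitive_root w -> N.-primitive_root w' ->
  root (map_poly ratr q) (cosz w 1) = root (map_poly ratr q) (cosz w' 1).
Proof.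
move=> wN w'N; have nz (K : numFieldType) (x : K) : N.-primitive_root x -> x != 0.
  by move=> xN; rewrite (prim_root_eq0 xN) -lt0n (prim_order_gt0 xN).
have liftP (K : numFieldType) (x : K) : N.-primitive_root x ->
    root (map_poly ratr q) (cosz x 1) = (map_poly intr 'Phi_N %| recip_lift q).
  move=> xN; rewrite -(prim_root_minpoly _ xN) /root recip_liftE ?nz //.
  by rewrite mulf_eq0 expf_eq0 (negbTE (nz _ _ xN)) andbF.
by rewrite (liftP _ _ wN) (liftP _ _ w'N).
Qed.

Lemma is_minpolyQ_uniq (R : realType) (a : R) (p0 p : {poly rat}) :
    p0 \is monic -> (forall q : {poly rat}, root (map_poly ratr q) a = (p0 %| q)) ->
  is_minpolyQ a p -> p = p0.
Proof.
move=> p0m p0P [pm pa pmin]; have p0p : p0 %| p by rewrite -p0P.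
have := pmin p0; rewrite monic_neq0 // p0P dvdpp => /(_ isT isT) size_p.
have : p0 %= p.
  by rewrite -dvdp_size_eqp // eqn_leq size_p dvdp_leq ?monic_neq0.
by rewrite (eqp_monic p0m pm) => /eqP.
Qed.

Lemma minpolyQ_eq (R : realType) (a : R) (p0 : {poly rat}) :
    p0 \is monic -> (forall q : {poly rat}, root (map_poly ratr q) a = (p0 %| q)) ->
  minpolyQ a = p0.
Proof.
move=> p0m p0P; apply: (is_minpolyQ_uniq p0m p0P).
apply: (xgetPex 0 (P := [set p | is_minpolyQ a p])); exists p0; split=> //.
  by rewrite p0P dvdpp.
by move=> q q0; rewrite p0P => /dvdp_leq ->.
Qed.

Definition expi (R : realType) (a : R) : R[i] := (cos a +i* sin a)%C.

Lemma expiX (R : realType) (a : R) (k : nat) : expi a ^+ k = expi (k%:R * a).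
Proof.
elim: k => [|k IH]; first by rewrite expr0 mul0r /expi cos0 sin0.
rewrite exprS IH /expi -natr1 mulrDl mul1r addrC cosD sinD.
by apply/eqP; rewrite eq_complex /=; apply/andP; split; apply/eqP; ring.
Qed.

Lemma expi_prim_root (R : realType) (n : nat) : (0 < n)%N ->
  n.-primitive_root (expi (2 * pi / n%:R) : R[i]).
Proof.
move=> n0; have n0' : n%:R != 0 :> R by rewrite pnatr_eq0 -lt0n.
have expn : expi (2 * pi / n%:R) ^+ n = 1 :> R[i].
  by rewrite expiX mulrCA divff // mulr1 /expi mulr_natl cos2pi -[pi *+ 2]add0r sinD2pi sin0.
have [m m_prim mn] := prim_order_exists n0 expn.
suff nm : n = m by rewrite {1}nm.
apply/eqP; rewrite eqn_leq [(m <= n)%N]dvdn_leq // andbT leqNgt.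
apply/negP => m_lt; have m0 := prim_order_gt0 m_prim.
have := prim_expr_order m_prim; rewrite expiX => /eqP; rewrite eq_complex /= => /andP [/eqP cos1 _].
pose y : R := m%:R * (pi / n%:R).
have yE : m%:R * (2 * pi / n%:R) = y *+ 2 by rewrite /y -mulr_natl; ring.
have n0R : 0 < n%:R :> R by rewrite ltr0n.
have y_lt : 0 < y < pi.
  rewrite /y mulrCA -ltr_pdivlMl ?pi_gt0 // mulr_gt0 ?pi_gt0 ?divr_gt0 ?ltr0n //=.
  by rewrite mulVf ?gt_eqF ?pi_gt0 // ltr_pdivrMr // mul1r ltr_nat.
have := sin_gt0_pi y_lt; move: cos1; rewrite yE cos_mulr2n => cos1 sin_y.
have := cos2Dsin2 y; have : 0 < sin y ^+ 2 by rewrite exprn_gt0.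
by lra.
Qed.

Lemma cosz_expi (R : realType) (a : R) : cosz (expi a) 1 = (2 * cos a)%:C%C.
Proof.
have -> : cosz (expi a) 1 = expi a + (expi a)^-1 by rewrite /cosz expr1z exprN1.
have inv : expi a * expi (- a) = 1.
  rewrite /expi cosN sinN; apply/eqP; rewrite eq_complex /=.
  by have := cos2Dsin2 a => e; apply/andP; split; apply/eqP; [rewrite -e|]; ring.
have -> : (expi a)^-1 = expi (- a).
  have e0 : expi a != 0.
    by apply: contra_eq_neq inv => ->; rewrite mul0r eq_sym oner_neq0.
  by apply: (mulfI e0); rewrite inv mulfV.
rewrite /expi cosN sinN; apply/eqP; rewrite eq_complex /=.
by apply/andP; split; apply/eqP; ring.
Qed.

(** The order N for which 2 sin(2 pi/n) = w + 1/w with w a primitive N-th root. *)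
Definition sin_order (n : nat) : nat := (4 * n %/ gcdn (n - 4) (4 * n))%N.

(** 2 sin(2 pi/n) is twice the cosine of (n - 4) 2 pi/(4 n). *)
Lemma sin_minpolyP (R : realType) (n : nat) (w : algC) :
    (4 < n)%N -> (sin_order n).-primitive_root w ->
  minpoly_algC (cosz w 1) (sin_minpoly R n).
Proof.
move=> n4 wN; have n0 : (0 < n)%N by apply: leq_trans n4.
have n0R : n%:R != 0 :> R by rewrite pnatr_eq0 -lt0n.
have n4' : (0 < 4 * n)%N by rewrite muln_gt0.
pose v : R[i] := expi (2 * pi / (4 * n)%:R).
have vN : (4 * n).-primitive_root v := expi_prim_root R n4'.
have uN : (sin_order n).-primitive_root (v ^+ (n - 4)) := exp_prim_root vN _.
have uE : cosz (v ^+ (n - 4)) 1 = (2 * sin (2 * pi / n%:R))%:C%C.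
  rewrite /v expiX cosz_expi; congr (_ * _)%:C%C.
  have -> : (n - 4)%:R * (2 * pi / (4 * n)%:R) = - (2 * pi / n%:R - pi / 2) :> R.
    by rewrite natrB ?(ltnW n4) // natrM; field.
  by rewrite cosN cosBpihalf.
have [p [_ p_monic] pP] := minCpolyP (cosz w 1).
suff -> : sin_minpoly R n = p by split.
apply: minpolyQ_eq => // q; rewrite -pP -(cosz_root_transfer _ uN wN) uE.
rewrite -(fmorph_root (real_complex R)) -map_poly_comp.
by congr (root _ _); apply: eq_map_poly => a; rewrite /= fmorph_rat.
Qed.

(** * The order and the degree as functions of n *)

Lemma odd_leq_totient_sq (n : nat) : odd n -> (n <= totient n ^ 2)%N.
Proof.
elim/ltn_ind: n => n IH on; have n0 : (0 < n)%N by case: (n) on.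
have [n1|n1] := leqP n 1; first by have -> : n = 1%N by lia.
have p_pr := pdiv_prime n1; have pn := pdiv_dvd n.
have [m [pm nE l0 tE]] := totient_split p_pr pn n0; set p := pdiv n in p_pr pn pm nE l0 tE.
have p3 : (3 <= p)%N by apply: odd_prime_gt2 => //; apply: dvdn_odd on.
move: nE tE; case: (logn p n) l0 => // l _ nE; rewrite /= => ->.
have m_n : (m %| n)%N by rewrite nE dvdn_mulr.
have m0 : (0 < m)%N by apply: dvdn_gt0 m_n.
have mn : (m < n)%N.
  rewrite nE -{1}[m]muln1 ltn_pmul2l // -{1}(exp1n l.+1) ltn_exp2r //; lia.
have := IH m mn (dvdn_odd m_n on) => m_le.
rewrite nE !expnMn leq_mul // expnS.
have pp : (p <= p.-1 ^ 2)%N by nia.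
apply: leq_mul pp _; rewrite -expnM leq_pexp2l //; lia.
Qed.

(** A crude bound that leaves finitely many orders of small totient. *)
Lemma leq_totient_sq (n : nat) : (0 < n)%N -> (n <= 2 * totient n ^ 2)%N.
Proof.
move=> n0; have [n2|n2] := boolP (2 %| n)%N; last first.
  by apply: leq_trans (odd_leq_totient_sq _) _; [rewrite dvdn2 negbK in n2 | lia].
have [m [pm nE l0 ->]] := totient_split (isT : prime 2) n2 n0.
have := odd_leq_totient_sq (n := m); rewrite -coprime2n => /(_ pm) m_le.
rewrite {1}nE; case: (logn 2 n) l0 => // l _ /=.
rewrite expnS mul1n expnMn mulnCA leq_mul2l /= leq_mul //.
by rewrite leq_pmulr // expn_gt0.
Qed.

Lemma small_totient (n : nat) : (0 < n)%N -> (totient n < 6)%N ->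
  n \in [:: 1; 2; 3; 4; 5; 6; 8; 10; 12]%N.
Proof.
move=> n0 t6; have n_le : (n < 51)%N by have := leq_totient_sq n0; nia.
have /allP /(_ n) : all (fun n => (0 < n)%N && (totient n < 6)%N ==>
  (n \in [:: 1; 2; 3; 4; 5; 6; 8; 10; 12]%N)) (iota 0 51) by vm_compute.
by rewrite mem_iota n_le n0 t6 /= => /(_ isT).
Qed.

(** gcd(n - 4, 4 n) = gcd(n - 4, 16). *)
Lemma sin_orderE (n : nat) : (4 < n)%N ->
  sin_order n = (4 * n %/ gcdn (n %% 16 + 12) 16)%N.
Proof.
move=> n4; rewrite /sin_order; congr (_ %/ _)%N.
have -> : (4 * n = 4 * (n - 4) + 16)%N by lia.
rewrite gcdnMDl -gcdn_modl -[RHS]gcdn_modl; congr gcdn.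
by rewrite modnDml -[RHS](modnMDl 0) mul0n add0n -(modnDr (n - 4)); congr modn; lia.
Qed.

(** n modulo 16 determines the order of the root of unity behind 2 sin(2 pi/n). *)
Variant sin_order_spec (n : nat) : nat -> Prop :=
  | SinOrderOdd of odd n : sin_order_spec n (4 * n)
  | SinOrderTwo m of odd m & n = (2 * m)%N : sin_order_spec n (4 * m)
  | SinOrderEight of (8 %| n)%N : sin_order_spec n n
  | SinOrderFour1 m of odd m & n = (4 * m)%N : sin_order_spec n m
  | SinOrderFour3 m of odd m & n = (4 * m)%N : sin_order_spec n (2 * m).

Lemma sin_orderP (n : nat) : (4 < n)%N -> sin_order_spec n (sin_order n).
Proof.
move=> n4; rewrite sin_orderE //; have r_lt := ltn_pmod n (isT : (0 < 16)%N).
have gcd_cases : [\/ odd n /\ gcdn (n %% 16 + 12) 16 = 1%N,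
    (n %% 4 = 2)%N /\ gcdn (n %% 16 + 12) 16 = 2%N, (n %% 8 = 0)%N /\ gcdn (n %% 16 + 12) 16 = 4%N
  | (n %% 8 = 4)%N /\ (gcdn (n %% 16 + 12) 16 = 16%N \/ gcdn (n %% 16 + 12) 16 = 8%N)].
  move rE : (n %% 16)%N r_lt => r r_lt.
  case: r r_lt rE => [|[|[|[|[|[|[|[|[|[|[|[|[|[|[|[|r]]]]]]]]]]]]]]]] //= _ nE;
    first [ by constructor 1; split; [lia | vm_compute]
          | by constructor 2; split; [lia | vm_compute]
          | by constructor 3; split; [lia | vm_compute]
          | by constructor 4; split; [lia | left; vm_compute]
          | by constructor 4; split; [lia | right; vm_compute]
          | idtac ].
case: gcd_cases => [[on ->]|[n2 ->]|[n8 ->]|[n8 []->]].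
- by rewrite divn1; constructor.
- have -> : (4 * n %/ 2 = 4 * (n %/ 2))%N by lia.
  by apply: SinOrderTwo; lia.
- have -> : (4 * n %/ 4 = n)%N by lia.
  by apply: SinOrderEight; apply/eqP.
- have -> : (4 * n %/ 16 = n %/ 4)%N by lia.
  by apply: SinOrderFour1; lia.
- have -> : (4 * n %/ 8 = 2 * (n %/ 4))%N by lia.
  by apply: SinOrderFour3; lia.
Qed.

Lemma totient_sin_order (n : nat) : (4 < n)%N ->
  totient (sin_order n) = (2 * sin_degree n)%N.
Proof.
move=> n4; have gcdE : gcdn n 8 = gcdn (n %% 8) 8 by rewrite gcdn_modl.
have coprime4 (m : nat) : odd m -> coprime 4 m.
  by rewrite -coprime2n; apply: (@coprimeXl 2 2 m).
have evenK (t : nat) : ~~ odd t -> (t = 2 * (t %/ 2))%N by lia.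
rewrite /sin_degree gcdE; case: (sin_orderP n4) => [on|m om nE|n8|m om nE|m om nE].
- have -> : (gcdn (n %% 8) 8 < 4)%N.
    have r_lt := ltn_pmod n (isT : (0 < 8)%N).
    have : odd (n %% 8) by lia.
    by case: (n %% 8)%N r_lt => [|[|[|[|[|[|[|[|r]]]]]]]].
  by rewrite totient_coprime // coprime4.
- have -> : (gcdn (n %% 8) 8 < 4)%N.
    have r_lt := ltn_pmod n (isT : (0 < 8)%N).
    have : (n %% 4 = 2)%N by lia.
    move rE : (n %% 8)%N r_lt => r r_lt.
    by case: r r_lt rE => [|[|[|[|[|[|[|[|r]]]]]]]] //; lia.
  by rewrite nE !totient_coprime ?coprime4 ?coprime2n // mulnA.
- rewrite (eqP n8) /=; rewrite -evenK // even_totient //; lia.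
- have -> : (n %% 8 = 4)%N by lia.
  rewrite /= nE totient_coprime ?coprime4 ?coprime2n //.
  have -> : (totient 4 * totient m %/ 4 = totient m %/ 2)%N.
    by rewrite (_ : totient 4 = 2)%N //; lia.
  rewrite -evenK // even_totient //; lia.
have -> : (n %% 8 = 4)%N by lia.
rewrite /= nE !totient_coprime ?coprime4 ?coprime2n //.
have -> : (totient 4 * totient m %/ 4 = totient m %/ 2)%N.
  by rewrite (_ : totient 4 = 2)%N //; lia.
by rewrite mul1n -evenK // even_totient //; lia.
Qed.

Lemma sin_degree_ge3 (n : nat) : (0 < n)%N ->
  n \notin [:: 1; 2; 3; 4; 6; 8; 12; 20]%N -> (4 < n)%N /\ (3 <= sin_degree n)%N.
Proof.
move=> n0 n_notin; have n4 : (4 < n)%N.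
  by case: n n0 n_notin => [|[|[|[|[|n]]]]].
split=> //; rewrite -(leq_pmul2l (isT : (0 < 2)%N)) -totient_sin_order // leqNgt.
apply: contra n_notin => t6.
have N0 : (0 < sin_order n)%N by case: (sin_orderP n4) => [on|m om nE|n8|m om nE|m om nE]; lia.
have := small_totient N0 t6; rewrite !inE.
by case: (sin_orderP n4) => [on|m om nE|n8|m om nE|m om nE]; lia.
Qed.

Lemma sin_order_four (n : nat) : (4 < n)%N -> n = 4 %[mod 8] ->
  exists2 m, odd m & n = (4 * m)%N /\ (sin_order n = m \/ sin_order n = 2 * m)%N.
Proof.
move=> n4 n8; case: (sin_orderP n4) => [on|m om nE|n8'|m om nE|m om nE]; try lia.
  by exists m => //; split; [|left].
by exists m => //; split; [|right].
Qed.

Lemma sin_order_other (n : nat) : (4 < n)%N -> n <> 4 %[mod 8] ->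
    n \notin [:: 6; 8; 24]%N ->
  (4 %| sin_order n)%N /\ sin_order n \notin [:: 4; 8; 12; 24]%N.
Proof.
move=> n4 n8; rewrite !inE.
case: (sin_orderP n4) => [on|m om nE|n8'|m om nE|m om nE]; lia.
Qed.

(** * Matrices acting on binary forms *)

Lemma minpoly_small_relation (t : algC) (p : {poly rat}) (s : seq rat) :
    minpoly_algC t p -> (size s < size p)%N ->
    \sum_(i < size s) ratr s`_i * t ^+ i = 0 -> forall i, s`_i = 0.
Proof.
case=> pm pP s_lt st i; have [s0|s0] := eqVneq (Poly s) 0.
  by rewrite -coef_Poly s0 coef0.
have : p %| Poly s.
  rewrite -pP; apply/rootP; rewrite (@horner_coef_wide _ (size s)).
    by rewrite -[RHS]st; apply: eq_bigr => j _; rewrite coef_map coef_Poly.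
  by rewrite size_map_poly size_Poly.
move/(dvdp_leq s0); rewrite leqNgt; case/negP.
by apply: leq_ltn_trans (size_Poly _) s_lt.
Qed.

Lemma minpoly_no_rational_root (t : algC) (p : {poly rat}) (a : rat) :
  minpoly_algC t p -> (2 < size p)%N -> ~~ root p a.
Proof.
move=> [pm pP] p3; apply/negP => /factor_theorem [q pE].
have p0 : p != 0 by rewrite monic_neq0.
have q0 : q != 0 by apply: contra_neq p0 => q0; rewrite pE q0 mul0r.
have : root (map_poly ratr p) t by rewrite pP.
rewrite pE rmorphM rootM !pP => /orP [] /dvdp_leq => [/(_ q0)|].
  by rewrite pE size_Mmonic ?monicXsubC // size_XsubC addn2 ltnn.
rewrite -size_poly_eq0 size_XsubC => /(_ isT); rewrite leqNgt p3 //.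
Qed.

Definition hom_eval (F : numFieldType) (p : {poly rat}) (x y : F) : F :=
  \sum_(i < size p) ratr p`_i * (x ^+ i * y ^+ ((size p).-1 - i)).

Definition form_eval (F : numFieldType) (G : bform) (x y : F) : F :=
  mmap ratr (fun i : 'I_2 => if i == 0 then x else y) G.

Lemma form_eval_hom (F : numFieldType) (p : {poly rat}) (x y : F) :
  form_eval (homogenization p) x y = hom_eval p x y.
Proof.
rewrite /form_eval /homogenization rmorph_sum /=; apply: eq_bigr => i _.
rewrite mmapZ; congr (_ * _); rewrite rmorphM !rmorphXn /= /Xvar !mmapX !mmap1U.
by [].
Qed.

Lemma form_evalN (F : numFieldType) (G : bform) (x y : F) :
  form_eval (- G) x y = - form_eval G x y.
Proof. by rewrite /form_eval rmorphN. Qed.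

Definition linear_form (M : 'M[rat]_2) (i : 'I_2) : bform :=
  M i 0 *: Xvar 0 + M i 1 *: Xvar 1.

Lemma sum_ord2 (V : nmodType) (f : 'I_2 -> V) : \sum_(j < 2) f j = f 0 + f 1.
Proof.
by rewrite big_ord_recl big_ord1; congr (_ + f _); apply/val_inj.
Qed.

Lemma subst_formE (G : bform) (M : 'M[rat]_2) :
  subst_form G M = comp_mpoly [tuple linear_form M i | i < 2] G.
Proof.
rewrite /subst_form; congr comp_mpoly; apply: eq_from_tnth => i.
by rewrite !tnth_mktuple sum_ord2.
Qed.

Lemma form_eval_subst (F : numFieldType) (G : bform) (M : 'M[rat]_2) (x y : F) :
  form_eval (subst_form G M) x y =
  form_eval G (ratr (M 0 0) * x + ratr (M 0 1) * y) (ratr (M 1 0) * x + ratr (M 1 1) * y).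
Proof.
rewrite subst_formE comp_mpolyE /form_eval rmorph_sum /= [RHS]/mmap.
apply: eq_bigr => m _; rewrite mmapZ; congr (_ * _).
rewrite rmorph_prod /mmap1; apply: eq_bigr => i _ /=.
rewrite rmorphXn tnth_mktuple; congr (_ ^+ _).
rewrite rmorphD /= !mmapZ /Xvar !mmapX !mmap1U /=.
by case: i => [[|[|i]] ilt] //=; congr (_ * _ + _ * _); congr (ratr (M _ _)); apply/val_inj.
Qed.

Lemma comp_mpoly_comp (la lb : 2.-tuple bform) (G : bform) :
  comp_mpoly lb (comp_mpoly la G) = comp_mpoly [tuple comp_mpoly lb (tnth la i) | i < 2] G.
Proof.
rewrite (comp_mpolyE G la) [RHS]comp_mpolyE rmorph_sum /=.
apply: eq_bigr => m _; rewrite comp_mpolyZ; congr (_ *: _).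
by rewrite rmorph_prod; apply: eq_bigr => i _ /=; rewrite rmorphXn tnth_mktuple.
Qed.

Lemma comp_linear_form (A B : 'M[rat]_2) (i : 'I_2) :
  comp_mpoly [tuple linear_form B j | j < 2] (linear_form A i) = linear_form (A *m B) i.
Proof.
rewrite {2}/linear_form rmorphD /= !comp_mpolyZ /Xvar !comp_mpolyXU.
have nthE (j : 'I_2) : [tuple linear_form B j | j < 2]`_j = linear_form B j.
  by rewrite -tnth_nth tnth_mktuple.
rewrite !nthE /linear_form !mxE !sum_ord2 !scalerDr !scalerA !scalerDl.
by rewrite addrACA.
Qed.

Lemma subst_form_comp (G : bform) (A B : 'M[rat]_2) :
  subst_form (subst_form G A) B = subst_form G (A *m B).
Proof.
rewrite (subst_formE G) [LHS]subst_formE [RHS]subst_formE comp_mpoly_comp.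
congr comp_mpoly; apply: eq_from_tnth => i; rewrite !tnth_mktuple.
exact: comp_linear_form.
Qed.

Lemma subst_form1 (G : bform) : subst_form G 1%:M = G.
Proof.
rewrite subst_formE -[RHS]comp_mpoly_id; congr comp_mpoly; apply: eq_from_tnth => i.
rewrite !tnth_mktuple /linear_form !mxE /Xvar.
by case: i => [[|[|i]] ilt] //=; rewrite scale1r scale0r ?addr0 ?add0r;
  congr (mpolyX _ (mnm1 _)); apply/val_inj.
Qed.

Lemma subst_formN (G : bform) (A : 'M[rat]_2) : subst_form (- G) A = - subst_form G A.
Proof. by rewrite /subst_form rmorphN. Qed.

Lemma subst_homE (p : {poly rat}) (M : 'M[rat]_2) :
  subst_form (homogenization p) M = \sum_(i < size p) p`_i *:
    (linear_form M 0 ^+ i * linear_form M 1 ^+ ((size p).-1 - i)).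
Proof.
rewrite subst_formE /homogenization rmorph_sum /=; apply: eq_bigr => i _.
rewrite comp_mpolyZ rmorphM !rmorphXn /= /Xvar !comp_mpolyXU.
by rewrite -!tnth_nth !tnth_mktuple.
Qed.

Lemma subst_hom_scale (p : {poly rat}) (s : rat) (M : 'M[rat]_2) :
  subst_form (homogenization p) (s *: M) =
  s ^+ (size p).-1 *: subst_form (homogenization p) M.
Proof.
rewrite !subst_homE scaler_sumr; apply: eq_bigr => i _.
have linZ j : linear_form (s *: M) j = s *: linear_form M j.
  by rewrite /linear_form !mxE scalerDr !scalerA.
have i_le : (i <= (size p).-1)%N by case: i => i /=; lia.
rewrite !linZ !exprZn -scalerAl -scalerAr !scalerA -mulrA -exprD subnKC //.
by rewrite mulrC.
Qed.

Lemma subst_hom_diag (p : {poly rat}) (M : 'M[rat]_2) :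
    M 0 1 = 0 -> M 1 0 = 0 ->
    (forall i, (i < size p)%N -> p`_i != 0 -> M 0 0 ^+ i * M 1 1 ^+ ((size p).-1 - i) = 1) ->
  subst_form (homogenization p) M = homogenization p.
Proof.
move=> M01 M10 Mp; rewrite subst_homE; apply: eq_bigr => i _.
have [->|pi0] := eqVneq p`_i 0; first by rewrite !scale0r.
rewrite /linear_form M01 M10 !scale0r addr0 add0r !exprZn -scalerAl -scalerAr !scalerA.
by rewrite -mulrA Mp ?mulr1.
Qed.

Lemma hom_eval1 (F : numFieldType) (p : {poly rat}) (x : F) :
  hom_eval p x 1 = (map_poly ratr p).[x].
Proof.
rewrite horner_coef size_map_poly; apply: eq_bigr => i _.
by rewrite coef_map expr1n mulr1.
Qed.

Lemma hom_evalZ (F : numFieldType) (p : {poly rat}) (c x y : F) :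
  hom_eval p (c * x) (c * y) = c ^+ (size p).-1 * hom_eval p x y.
Proof.
rewrite /hom_eval mulr_sumr; apply: eq_bigr => i _.
have i_le : (i <= (size p).-1)%N by case: i => i /=; lia.
rewrite (_ : c ^+ (size p).-1 = c ^+ i * c ^+ ((size p).-1 - i)).
  by rewrite !exprMn; ring.
by rewrite -exprD subnKC.
Qed.

Lemma hom_eval0 (F : numFieldType) (p : {poly rat}) (x : F) : p \is monic ->
  hom_eval p x 0 = x ^+ (size p).-1.
Proof.
move=> pm; have p0 : (0 < size p)%N by rewrite size_poly_gt0 monic_neq0.
have lt : ((size p).-1 < size p)%N by rewrite prednK.
rewrite /hom_eval (bigD1 (Ordinal lt)) //= subnn expr0 mulr1 big1 ?addr0.
  by rewrite -lead_coefE (monicP pm) rmorph1 mul1r.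
move=> i i_max; rewrite expr0n subn_eq0.
have -> : ((size p).-1 <= i)%N = false by case: i i_max => i ilt; rewrite -val_eqE /=; lia.
by rewrite !mulr0.
Qed.

Lemma hom_evalE (F : numFieldType) (p : {poly rat}) (x y : F) : y != 0 ->
  hom_eval p x y = y ^+ (size p).-1 * (map_poly ratr p).[x / y].
Proof.
by move=> y0; rewrite -hom_eval1 -hom_evalZ mulr1 mulrC divfK.
Qed.

Lemma AutAbs_eval (F : numFieldType) (p : {poly rat}) (M : 'M[rat]_2) (x y : F) :
    AutAbs (homogenization p) M ->
  exists2 e : F, e = 1 \/ e = -1 &
  hom_eval p (ratr (M 0 0) * x + ratr (M 0 1) * y)
             (ratr (M 1 0) * x + ratr (M 1 1) * y) = e * hom_eval p x y.
Proof.
rewrite -!form_eval_hom -form_eval_subst => -[]->; [exists 1|exists (-1)]; auto.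
  by rewrite mul1r.
by rewrite form_evalN mulN1r.
Qed.

Lemma Aut_eval (F : numFieldType) (p : {poly rat}) (M : 'M[rat]_2) (x y : F) :
    Aut (homogenization p) M ->
  hom_eval p (ratr (M 0 0) * x + ratr (M 0 1) * y)
             (ratr (M 1 0) * x + ratr (M 1 1) * y) = hom_eval p x y.
Proof. by rewrite -!form_eval_hom -form_eval_subst => ->. Qed.

Lemma Aut_AutAbs (G : bform) : Aut G `<=` AutAbs G.
Proof. by move=> M; left. Qed.

Lemma homogenization_neq0 (p : {poly rat}) : p \is monic -> homogenization p != 0.
Proof.
move=> pm; apply: contra_eq_neq (hom_eval0 (1 : algC) pm) => p0.
by rewrite -form_eval_hom p0 /form_eval raddf0 expr1n eq_sym oner_neq0.
Qed.

(** The relation is written without division; the last clause records that its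
    denominator is nonzero. *)
Lemma AutAbs_moebius (t : algC) (p : {poly rat}) (M : 'M[rat]_2) :
    minpoly_algC t p -> (2 < size p)%N -> AutAbs (homogenization p) M ->
  exists z, [/\ root (map_poly ratr p) z,
    (ratr (M 1 0) * t + ratr (M 1 1)) * z = ratr (M 0 0) * t + ratr (M 0 1) &
    M 1 0 != 0 \/ M 1 1 != 0].
Proof.
move=> tp p3 AM; have [pm _] := tp.
have [e e1] := AutAbs_eval t 1 AM; rewrite !mulr1 hom_eval1.
have /rootP -> := minpoly_algC_root tp; rewrite mulr0 => hom0.
have lin0 (a b : rat) : ratr b * t + ratr a = 0 -> a = 0 /\ b = 0.
  move=> ab0; have := minpoly_small_relation (s := [:: a; b]) tp p3.
  rewrite !big_ord_recl big_ord0 /= expr0 expr1 mulr1 addr0 addrC => /(_ ab0) s0.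
  by split; [exact: (s0 0%N) | exact: (s0 1%N)].
have [y0|y0] := eqVneq (ratr (M 1 0) * t + ratr (M 1 1)) 0; last first.
  exists ((ratr (M 0 0) * t + ratr (M 0 1)) / (ratr (M 1 0) * t + ratr (M 1 1))).
  split.
  - apply/rootP; move/eqP: hom0; rewrite hom_evalE // mulf_eq0 expf_eq0 (negbTE y0) andbF.
    by move/eqP.
  - by rewrite mulrC divfK.
  apply/orP; apply: contraNT y0; rewrite negb_or !negbK => /andP [/eqP -> /eqP ->].
  by rewrite rmorph0 mul0r addr0.
rewrite y0 hom_eval0 // in hom0; have [M11 M10] := lin0 _ _ y0.
move/eqP: hom0; rewrite expf_eq0 => /andP [_ /eqP /lin0 [M01 M00]].
have [e' e'1] := AutAbs_eval (1 : algC) 0 AM.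
rewrite M00 M01 M10 M11 !rmorph0 !mul0r addr0 !hom_eval0 // expr1n mulr1 expr0n.
have -> : ((size p).-1 == 0)%N = false by lia.
move=> e'0; case: e'1 => e'E; move/eqP: e'0; rewrite e'E eq_sym ?oppr_eq0 oner_eq0 //.
Qed.

(** The form would vanish at a nonzero kernel vector, giving p a rational root. *)
Lemma AutAbs_unit (t : algC) (p : {poly rat}) (M : 'M[rat]_2) :
    minpoly_algC t p -> (2 < size p)%N -> AutAbs (homogenization p) M ->
  M \in unitmx.
Proof.
move=> tp p3 AM; have [pm _] := tp; rewrite unitmxE unitfE; apply/negP => det0.
have /det0P [v v0 vM] : \det M^T == 0 by rewrite det_tr.
have vE (i : 'I_2) : ratr (M i 0) * ratr (v 0 0) + ratr (M i 1) * ratr (v 0 1) = 0 :> algC.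
  have := congr1 (fun A : 'rV_2 => A 0 i) vM; rewrite !mxE sum_ord2 !mxE => vM0.
  by rewrite -!rmorphM -rmorphD /= mulrC [M i 1 * _]mulrC vM0 rmorph0.
have [e e1] := AutAbs_eval (ratr (v 0 0) : algC) (ratr (v 0 1)) AM.
rewrite !vE hom_eval0 // expr0n (_ : (_ == 0)%N = false); last by lia.
move/esym/eqP; rewrite mulf_eq0 (_ : (e == 0) = false) /=; last first.
  by case: e1 => ->; rewrite ?oppr_eq0 oner_eq0.
have [v1|v1] := eqVneq (v 0 1) 0.
  rewrite v1 rmorph0 hom_eval0 // expf_eq0 ratr_eq0 => /andP [_ /eqP v00].
  case/eqP: v0; apply/rowP => i; rewrite mxE.
  by case: i => [[|[|i]] ilt] //; [rewrite -v00|rewrite -v1]; congr (v _ _); apply/val_inj.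
rewrite hom_evalE ?ratr_eq0 // mulf_eq0 expf_eq0 ratr_eq0 (negbTE v1) andbF /=.
rewrite -fmorph_div -/(root _ _) fmorph_root.
by rewrite (negbTE (minpoly_no_rational_root _ tp p3)).
Qed.

Lemma subst_form_inv (G : bform) (M : 'M[rat]_2) :
  M \in unitmx -> subst_form G M = G -> subst_form G (invmx M) = G.
Proof. by move=> uM GM; rewrite -{1}GM subst_form_comp mulmxV // subst_form1. Qed.

Lemma Aut_subgroup (t : algC) (p : {poly rat}) :
    minpoly_algC t p -> (2 < size p)%N -> is_subgroup (Aut (homogenization p)).
Proof.
move=> tp p3; split=> [M AM||A B AA AB|A AA] /=.
- exact: AutAbs_unit tp p3 (or_introl AM).
- exact: subst_form1.
- by rewrite /Aut /= -subst_form_comp AA.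
apply: subst_form_inv => //; exact: AutAbs_unit tp p3 (or_introl AA).
Qed.

Lemma AutAbs_subgroup (t : algC) (p : {poly rat}) :
    minpoly_algC t p -> (2 < size p)%N -> is_subgroup (AutAbs (homogenization p)).
Proof.
move=> tp p3; split=> [M AM||A B AA AB|A AA] /=.
- exact: AutAbs_unit tp p3 AM.
- by left; exact: subst_form1.
- rewrite /AutAbs /= -subst_form_comp.
  case: AA => ->; rewrite ?subst_formN; case: AB => ->; rewrite ?opprK; auto.
have uA := AutAbs_unit tp p3 AA; case: AA => AE; first by left; apply: subst_form_inv.
right; set G := homogenization p in AE *.
by rewrite -{1}[G]opprK -{1}AE subst_formN subst_form_comp mulmxV // subst_form1.
Qed.

(** * Groups of matrices and their generators *)

Lemma mx2E (M : 'M[rat]_2) : M = mx2 (M 0 0) (M 0 1) (M 1 0) (M 1 1).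
Proof.
apply/matrixP => i j; rewrite mxE.
by case: i => [[|[|i]] ilt] //=; case: j => [[|[|j]] jlt] //=;
  congr (M _ _); apply/val_inj.
Qed.

Lemma mx2M (s u t v s' u' t' v' : rat) : mx2 s u t v *m mx2 s' u' t' v' =
  mx2 (s * s' + u * t') (s * u' + u * v') (t * s' + v * t') (t * u' + v * v').
Proof.
apply/matrixP=> i j; rewrite !mxE sum_ord2 !mxE /=.
by case: (i == 0); case: (j == 0).
Qed.

Lemma mx2Z (c s u t v : rat) : c *: mx2 s u t v = mx2 (c * s) (c * u) (c * t) (c * v).
Proof. by apply/matrixP=> i j; rewrite !mxE; case: (i == 0); case: (j == 0). Qed.

Lemma mx2_1 : mx2 1 0 0 1 = 1%:M.
Proof. by rewrite [RHS]mx2E !mxE. Qed.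

Lemma mx2_N1 : mx2 (-1) 0 0 (-1) = - 1%:M.
Proof. by rewrite -mx2_1 -scaleN1r mx2Z !mulr1 !mulr0. Qed.

Lemma mx2_entries (s u t v : rat) : [/\ mx2 s u t v 0 0 = s, mx2 s u t v 0 1 = u,
  mx2 s u t v 1 0 = t & mx2 s u t v 1 1 = v].
Proof. by split; rewrite mxE. Qed.

Lemma generated_sub (S T : set 'M[rat]_2) :
  S `<=` generated T -> generated S `<=` generated T.
Proof. by move=> ST A SA G [sG TG]; apply: SA; split=> // B /ST; apply. Qed.

Lemma generated1 (S : set 'M[rat]_2) : generated S 1%:M.
Proof. by move=> G [[_ G1 _ _] _]. Qed.

Lemma generatedM (S : set 'M[rat]_2) (A B : 'M[rat]_2) :
  generated S A -> generated S B -> generated S (A *m B).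
Proof.
by move=> SA SB G GP; have [[_ _ GM _] _] := GP; apply: GM; [apply: SA|apply: SB].
Qed.

(** Pull a subgroup containing the conjugated generators back along conjugation. *)
Lemma generated_conj (S : set 'M[rat]_2) (P A : 'M[rat]_2) : P \in unitmx ->
  generated S A -> generated [set P *m B *m invmx P | B in S] (P *m A *m invmx P).
Proof.
move=> uP SA G [[Gu G1 GM GV] SG].
apply: (SA [set B | G (P *m B *m invmx P)]); split; last first.
  by move=> B SB; apply: SG; exists B.
split=> /= [B /Gu /=||B C GB GC|B GB].
- by rewrite !unitmx_mul unitmx_inv uP andbT.
- by rewrite mulmx1 mulmxV.
- have -> : P *m (B *m C) *m invmx P = (P *m B *m invmx P) *m (P *m C *m invmx P).
    by rewrite !mulmxA mulmxKV.
  exact: GM.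
have uB : B \in unitmx by move: (Gu _ GB); rewrite /= !unitmx_mul unitmx_inv uP andbT.
have := GV _ GB; have -> : invmx (P *m B *m invmx P) = P *m invmx B *m invmx P => //.
have uPB : P *m B *m invmx P \in unitmx by exact: Gu.
apply: (can_inj (mulKmx uPB)); rewrite mulmxV // !mulmxA mulmxKV // mulmxK //.
by rewrite mulmxV.
Qed.

(** It suffices to check the conjugation on generators, in both directions. *)
Lemma conjugate_generated (S T : set 'M[rat]_2) (P : 'M[rat]_2) : P \in unitmx ->
    (forall A, S A -> generated T (P *m A *m invmx P)) ->
    (forall B, T B -> exists2 A, generated S A & B = P *m A *m invmx P) ->
  conjugate (generated T) (generated S).
Proof.
move=> uP ST TS; exists P => //; apply/seteqP; split=> B.
  have uV : invmx P \in unitmx by rewrite unitmx_inv.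
  move=> TB; exists (invmx P *m B *m P); last first.
    by rewrite !mulmxA mulmxV // mul1mx mulmxK.
  have := generated_conj uV TB; rewrite invmxK; apply: generated_sub.
  move=> _ [C /TS [A SA ->] <-].
  by rewrite !mulmxA mulVmx // mul1mx mulmxKV.
move=> [A SA <-]; have := generated_conj uP SA; apply: generated_sub.
by move=> _ [C SC <-]; apply: ST.
Qed.

Lemma conjugate_isomorphic (G H : set 'M[rat]_2) : conjugate G H -> isomorphic G H.
Proof.
case=> P uP ->; have uV : invmx P \in unitmx by rewrite unitmx_inv.
have PK (A : 'M[rat]_2) : invmx P *m (P *m A *m invmx P) *m P = A.
  by rewrite !mulmxA mulVmx // mul1mx mulmxKV.
exists (fun A => invmx P *m A *m P); last first.
  by move=> A B _ _; rewrite !mulmxA mulmxK.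
split.
- by move=> _ [A HA <-]; rewrite PK.
- by move=> _ _ /set_mem [A HA <-] /set_mem [B HB <-]; rewrite !PK => ->.
by move=> A HA; exists (P *m A *m invmx P); [exists A | rewrite PK].
Qed.

Lemma isomorphic_refl (G : set 'M[rat]_2) : isomorphic G G.
Proof.
by exists id => //; split; [by [] | by move=> A B _ _ | by move=> A GA; exists A].
Qed.

Lemma rat_unity_root (s : rat) (k : nat) :
  (0 < k)%N -> s ^+ k = 1 \/ s ^+ k = -1 -> s = 1 \/ s = -1.
Proof.
move=> k0 sk; have s1 : `|s| = 1.
  apply/eqP; rewrite -(pexpr_eq1 k0) // -normrX.
  by case: sk => ->; rewrite ?normrN normr1.
by case: (ler0P s) s1 => _ <-; [right; rewrite opprK | left].
Qed.

(** Matrices with the same action on a root are proportional; this bounds the factor. *)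
Lemma AutAbs_scale (p : {poly rat}) (s : rat) (g : 'M[rat]_2) :
    p \is monic -> (2 < size p)%N -> Aut (homogenization p) g ->
    AutAbs (homogenization p) (s *: g) ->
  (s = 1 \/ s = -1) /\ (Aut (homogenization p) (s *: g) -> s ^+ (size p).-1 = 1).
Proof.
move=> pm p3 gA; have F0 := homogenization_neq0 pm.
have scaleE (c : rat) : c *: homogenization p = 0 -> c = 0.
  by move/eqP; rewrite scaler_eq0 (negbTE F0) orbF => /eqP.
have D0 : (0 < (size p).-1)%N by lia.
have s1 : Aut (homogenization p) (s *: g) -> s ^+ (size p).-1 = 1.
  rewrite /Aut /= subst_hom_scale gA => /eqP; rewrite -subr_eq0 -{2}[homogenization p]scale1r.
  by rewrite -scalerBl => /eqP /scaleE /eqP; rewrite subr_eq0 => /eqP.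
split=> //; apply: (rat_unity_root D0); case: H => [/s1|]; first by left.
rewrite subst_hom_scale gA => /eqP; rewrite -addr_eq0 -{2}[homogenization p]scale1r.
by rewrite -scalerDl => /eqP /scaleE /eqP; rewrite addr_eq0 => /eqP; right.
Qed.

Lemma horner_map_Poly (s : seq rat) (x : algC) :
  (map_poly ratr (Poly s)).[x] = \sum_(i < size s) ratr s`_i * x ^+ i.
Proof.
rewrite (@horner_coef_wide _ (size s)); last by rewrite size_map_poly size_Poly.
by apply: eq_bigr => j _; rewrite coef_map coef_Poly.
Qed.

(** Evaluating in an arbitrary commutative algebra makes the invariance of an
    explicit form an identity in two variables. *)
Definition form_at (A : comAlgType rat) (s : seq rat) (x y : A) : A :=
  \sum_(i < size s) s`_i *: (x ^+ i * y ^+ ((size s).-1 - i)).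

Lemma linear_form_mx2 (s u t v : rat) :
  linear_form (mx2 s u t v) 0 = s *: Xvar 0 + u *: Xvar 1 /\
  linear_form (mx2 s u t v) 1 = t *: Xvar 0 + v *: Xvar 1.
Proof. by rewrite /linear_form; have [-> -> -> ->] := mx2_entries s u t v. Qed.

Lemma Aut_Poly (l : seq rat) (s u t v : rat) : last 1 l != 0 ->
    (forall (A : comAlgType rat) (x y : A),
       form_at l (s *: x + u *: y) (t *: x + v *: y) = form_at l x y) ->
  Aut (homogenization (Poly l)) (mx2 s u t v).
Proof.
move=> l0 inv; rewrite /Aut /= subst_homE /homogenization (PolyK l0).
have [-> ->] := linear_form_mx2 s u t v; exact: inv.
Qed.

(** * The simplest cubics: n = 28 and n = 36 *)

(** Shanks' simplest cubics: their roots are permuted by x -> (x - 1)/x. The cases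
    n = 28 and n = 36 are a = 1 and a = 0. *)
Definition cubic_coefs (a : rat) : seq rat := [:: 1; a - 3; - a; 1].
Definition cubic (a : rat) : {poly rat} := Poly (cubic_coefs a).

Definition rot3 : 'M[rat]_2 := mx2 (-1) 1 (-1) 0.

Lemma cubic_rot3 (a : rat) : Aut (homogenization (cubic a)) rot3.
Proof.
apply: Aut_Poly => [|A x y]; first exact: oner_neq0.
rewrite /form_at /= !big_ord_recl !big_ord0 /= /bump /= !subn0 ?subSS ?subn0 !expr0.
have [b bE] : exists b : A, forall z, a *: z = b * z.
  by exists a%:A => z; rewrite mulr_algl.
rewrite !scaleN1r !scale1r !scale0r !scalerBl !scaleNr !scaler_nat !bE; ring.
Qed.

Lemma size_cubic (a : rat) : size (cubic a) = 4%N.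
Proof. by rewrite /cubic (@PolyK _ 1) ?oner_neq0. Qed.

Lemma cubic_monic (a : rat) : cubic a \is monic.
Proof. by rewrite monicE lead_coefE size_cubic /cubic (@PolyK _ 1) ?oner_neq0. Qed.

Lemma root_cubic (a : rat) (x : algC) :
  root (map_poly ratr (cubic a)) x = (x ^+ 3 - ratr a * x ^+ 2 + (ratr a - 3) * x + 1 == 0).
Proof.
rewrite /root horner_map_Poly !big_ord_recl big_ord0 /= rmorphB rmorphN /= rmorph1 rmorph_nat.
by congr (_ == 0); rewrite /bump /=; ring.
Qed.

(** The image of t is one of the three roots t, (t - 1)/t and 1/(1 - t), and t has
    degree 3, so that each of them determines the matrix up to a factor. *)
Lemma cubic_AutAbs_scale (t : algC) (a : rat) (M : 'M[rat]_2) :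
    minpoly_algC t (cubic a) -> AutAbs (homogenization (cubic a)) M ->
  exists s g, M = s *: g /\ [\/ g = 1%:M, g = rot3 | g = rot3 *m rot3].
Proof.
move=> tp AM; have p3 : (2 < size (cubic a))%N by rewrite size_cubic.
have [z [pz rel _]] := AutAbs_moebius tp p3 AM.
have := minpoly_algC_root tp; rewrite root_cubic => /eqP pt.
move: pz; rewrite root_cubic => /eqP pz.
have quad0 (x y w : rat) : ratr x + ratr y * t + ratr w * t ^+ 2 = 0 ->
    [/\ x = 0, y = 0 & w = 0].
  move=> xyw; have := minpoly_small_relation (s := [:: x; y; w]) tp.
  rewrite size_cubic !big_ord_recl big_ord0 /= /bump /= expr0 expr1 mulr1 addr0 addrA.
  by move=> /(_ isT xyw) s0; split; [exact: (s0 0%N) | exact: (s0 1%N) | exact: (s0 2%N)].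
(* t (1 - t) (p(z) - p(t)) factors over the Moebius images of t, modulo p(t) *)
have : (z - t) * ((z * t - t + 1) * (z * (1 - t) - 1)) = 0.
  set A : algC := ratr a in pt pz.
  have -> : (z - t) * ((z * t - t + 1) * (z * (1 - t) - 1)) =
      t * (1 - t) * (z ^+ 3 - A * z ^+ 2 + (A - 3) * z + 1) -
      (t * (1 - t) + (z - t) * (1 - t - z)) * (t ^+ 3 - A * t ^+ 2 + (A - 3) * t + 1).
    by ring.
  by rewrite pz pt; ring.
have ME := mx2E M; move: (M 0 0) (M 0 1) (M 1 0) (M 1 1) ME rel => s u r v -> rel.
have {}rel : (ratr r * t + ratr v) * z - (ratr s * t + ratr u) = 0 by rewrite rel subrr.
have rot3sq : rot3 *m rot3 = mx2 0 (-1) 1 (-1) by rewrite mx2M; congr mx2.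
move/eqP; rewrite !mulf_eq0 => /or3P [] /eqP zE.
- have [|/eqP] := quad0 (- u) (v - s) r.
    rewrite rmorphB rmorphN /=; have zt : z = t by apply/eqP; rewrite -subr_eq0 zE.
    by rewrite -[RHS]rel zt; ring.
  rewrite oppr_eq0 => /eqP -> /eqP; rewrite subr_eq0 => /eqP -> ->.
  exists s, 1%:M; split; last by constructor 1.
  by rewrite -mx2_1 mx2Z !mulr1 !mulr0.
- have [|/eqP] := quad0 (- v) (v - r - u) (r - s).
    rewrite !rmorphB rmorphN /=.
    transitivity (t * ((ratr r * t + ratr v) * z - (ratr s * t + ratr u)) -
      (ratr r * t + ratr v) * (z * t - t + 1)); first by ring.
    by rewrite rel zE !mulr0 subrr.
  rewrite oppr_eq0 => /eqP -> /eqP; rewrite sub0r subr_eq0 => /eqP <- /eqP.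
  rewrite subr_eq0 => /eqP <-; exists (- r), rot3; split; last by constructor 2.
  by rewrite mx2Z mulrN1 opprK mulr1 mulr0.
have [|/eqP] := quad0 (u - v) (s - u - r) (- s).
  rewrite !rmorphB rmorphN /=.
  transitivity ((ratr r * t + ratr v) * (z * (1 - t) - 1) -
    (1 - t) * ((ratr r * t + ratr v) * z - (ratr s * t + ratr u))); first by ring.
  by rewrite rel zE !mulr0 subrr.
rewrite subr_eq0 => /eqP <- /eqP + /eqP; rewrite oppr_eq0 => + /eqP s0.
rewrite s0 sub0r subr_eq0 => /eqP <-; exists (- u), (rot3 *m rot3); split; last by constructor 3.
by rewrite rot3sq mx2Z mulrN1 opprK mulr1 mulr0.
Qed.

Lemma generated_rot3 (S : set 'M[rat]_2) (g : 'M[rat]_2) : S rot3 ->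
  [\/ g = 1%:M, g = rot3 | g = rot3 *m rot3] -> generated S g.
Proof.
move=> S3; case=> ->; first exact: generated1.
  exact: sub_generated.
by apply: generatedM; apply: sub_generated.
Qed.

Lemma cubic_Aut_powers (t : algC) (a : rat) (g : 'M[rat]_2) :
    minpoly_algC t (cubic a) -> [\/ g = 1%:M, g = rot3 | g = rot3 *m rot3] ->
  Aut (homogenization (cubic a)) g.
Proof.
move=> tp /(generated_rot3 (S := [set rot3]) erefl); apply: generated_min.
  by apply: (Aut_subgroup tp); rewrite size_cubic.
by move=> _ ->; apply: cubic_rot3.
Qed.

Lemma cubic_Aut (t : algC) (a : rat) : minpoly_algC t (cubic a) ->
  Aut (homogenization (cubic a)) = generated [set rot3].
Proof.
move=> tp; have p3 : (2 < size (cubic a))%N by rewrite size_cubic.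
apply/seteqP; split=> M.
  move=> AM; have [s [g [ME gP]]] := cubic_AutAbs_scale tp (Aut_AutAbs AM).
  have gA := cubic_Aut_powers tp gP; rewrite ME in AM *.
  have [s1 /(_ AM)] := AutAbs_scale (cubic_monic a) p3 gA (Aut_AutAbs AM).
  rewrite size_cubic /=; case: s1 => ->; first by rewrite scale1r => _; apply: generated_rot3.
  by [].
by move=> GM; apply: (generated_min (Aut_subgroup tp p3) _ GM) => _ ->; apply: cubic_rot3.
Qed.

Lemma cubic_AutAbs (t : algC) (a : rat) : minpoly_algC t (cubic a) ->
  AutAbs (homogenization (cubic a)) = generated [set rot3; mx2 (-1) 0 0 (-1)].
Proof.
move=> tp; have p3 : (2 < size (cubic a))%N by rewrite size_cubic.
apply/seteqP; split=> M.
  move=> AM; have [s [g [ME gP]]] := cubic_AutAbs_scale tp AM.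
  have gA := cubic_Aut_powers tp gP; rewrite ME in AM *.
  have [s1 _] := AutAbs_scale (cubic_monic a) p3 gA AM.
  have gG := generated_rot3 (S := [set rot3; mx2 (-1) 0 0 (-1)]) (or_introl erefl) gP.
  case: s1 => ->; first by rewrite scale1r.
  have -> : -1 *: g = mx2 (-1) 0 0 (-1) *m g by rewrite mx2_N1 mulNmx mul1mx scaleN1r.
  apply: generatedM gG.
  by apply: sub_generated; right.
move=> GM; apply: (generated_min (AutAbs_subgroup tp p3) _ GM) => _ [] ->.
  exact/Aut_AutAbs/cubic_rot3.
right; rewrite mx2_N1 -scaleN1r subst_hom_scale subst_form1 size_cubic /=.
by rewrite -signr_odd scaleN1r.
Qed.

Lemma rot3_conjugate_C3 : conjugate (generated [set rot3]) C3.
Proof.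
pose P := mx2 0 1 (-1) 0; pose Q := mx2 0 (-1) 1 0.
have PQ : P *m Q = 1%:M by rewrite mx2M -mx2_1; congr mx2.
have [uP _] := mulmx1_unit PQ.
have PV : invmx P = Q by rewrite -[LHS]mulmx1 -PQ mulKmx.
have PE : P *m mx2 0 1 (-1) (-1) *m invmx P = rot3.
  by rewrite PV !mx2M; congr mx2.
apply: (conjugate_generated uP) => [_ ->|_ ->].
  by rewrite PE; apply: sub_generated.
by exists (mx2 0 1 (-1) (-1)); [apply: sub_generated | rewrite PE].
Qed.

Lemma rot3_conjugate_C6 :
  conjugate (generated [set rot3; mx2 (-1) 0 0 (-1)]) C6.
Proof.
pose h := mx2 0 1 (-1) 1; have hG : generated [set h] h by apply: sub_generated.
have h2 : h *m h = rot3 by rewrite mx2M; congr mx2.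
have h3 : h *m rot3 = mx2 (-1) 0 0 (-1) by rewrite mx2M; congr mx2.
have hE : mx2 (-1) 0 0 (-1) *m (rot3 *m rot3) = h by rewrite !mx2M; congr mx2.
apply: (@conjugate_generated _ _ 1%:M); first exact: unitmx1.
  move=> _ ->; rewrite invmx1 mulmx1 mul1mx -[mx2 0 1 _ _]hE.
  by do 2?apply: generatedM; apply: sub_generated; [right | left | left].
move=> B SB; exists B; last by rewrite invmx1 mulmx1 mul1mx.
case: SB => ->; first by rewrite -h2; apply: generatedM.
by rewrite -h3; apply: generatedM => //; rewrite -h2; apply: generatedM.
Qed.

(** * Two quartics: n = 60 and n = 24 *)

Definition quartic60 : {poly rat} := Poly [:: 1; - 4; - 4; 1; 1].
Definition quartic24 : {poly rat} := Poly [:: 1; 0; - 4; 0; 1].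

Lemma size_quartic60 : size quartic60 = 5%N.
Proof. by rewrite /quartic60 (@PolyK _ 1) ?oner_neq0. Qed.

Lemma size_quartic24 : size quartic24 = 5%N.
Proof. by rewrite /quartic24 (@PolyK _ 1) ?oner_neq0. Qed.

Lemma quartic60_monic : quartic60 \is monic.
Proof. by rewrite monicE lead_coefE size_quartic60 /quartic60 (@PolyK _ 1) ?oner_neq0. Qed.

Lemma quartic24_monic : quartic24 \is monic.
Proof. by rewrite monicE lead_coefE size_quartic24 /quartic24 (@PolyK _ 1) ?oner_neq0. Qed.

Lemma root_quartic60 (x : algC) :
  root (map_poly ratr quartic60) x = (x ^+ 4 + x ^+ 3 - 4 * x ^+ 2 - 4 * x + 1 == 0).
Proof.
rewrite /root horner_map_Poly !big_ord_recl big_ord0 /= rmorphN /= rmorph1 rmorph_nat.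
by congr (_ == 0); rewrite /bump /=; ring.
Qed.

Lemma root_quartic24 (x : algC) :
  root (map_poly ratr quartic24) x = (x ^+ 4 - 4 * x ^+ 2 + 1 == 0).
Proof.
rewrite /root horner_map_Poly !big_ord_recl big_ord0 /= rmorphN /= rmorph1 rmorph0 rmorph_nat.
by congr (_ == 0); rewrite /bump /=; ring.
Qed.

Definition rot4 : 'M[rat]_2 := mx2 1 2 (-1) (-1).

Lemma quartic60_rot4 : Aut (homogenization quartic60) rot4.
Proof.
apply: Aut_Poly => [|A x y]; first exact: oner_neq0.
rewrite /form_at /= !big_ord_recl !big_ord0 /= /bump /= !subn0 ?subSS ?subn0 !expr0.
rewrite !scaleN1r !scale1r !scaleNr !scaler_nat; ring.
Qed.

Lemma quartic24_swap : Aut (homogenization quartic24) (mx2 0 1 1 0).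
Proof.
apply: Aut_Poly => [|A x y]; first exact: oner_neq0.
rewrite /form_at /= !big_ord_recl !big_ord0 /= /bump /= !subn0 ?subSS ?subn0 !expr0.
rewrite !scale1r !scale0r !scaleNr !scaler_nat; ring.
Qed.

Lemma quartic24_quarter_turn : Aut (homogenization quartic24) (mx2 0 1 (-1) 0).
Proof.
apply: Aut_Poly => [|A x y]; first exact: oner_neq0.
rewrite /form_at /= !big_ord_recl !big_ord0 /= /bump /= !subn0 ?subSS ?subn0 !expr0.
rewrite !scaleN1r !scale1r !scale0r !scaleNr !scaler_nat; ring.
Qed.

Lemma minpoly_cubic_relation (t : algC) (p : {poly rat}) (x y w q : rat) :
    minpoly_algC t p -> (4 < size p)%N ->
    ratr x + ratr y * t + ratr w * t ^+ 2 + ratr q * t ^+ 3 = 0 ->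
  [/\ x = 0, y = 0, w = 0 & q = 0].
Proof.
move=> tp p4 rel; have := minpoly_small_relation (s := [:: x; y; w; q]) tp p4.
rewrite !big_ord_recl big_ord0 /= /bump /= expr0 expr1 mulr1 addr0 !addrA => /(_ rel) s0.
by split; [exact: (s0 0%N) | exact: (s0 1%N) | exact: (s0 2%N) | exact: (s0 3%N)].
Qed.

(** Among the four roots t, - (t + 2)/(t + 1), 2 - t^2 and (4 - t^2)/(t^2 - 3),
    only the first two are Moebius images of t. *)
Lemma quartic60_AutAbs_scale (t : algC) (M : 'M[rat]_2) :
    minpoly_algC t quartic60 -> AutAbs (homogenization quartic60) M ->
  exists s g, M = s *: g /\ (g = 1%:M \/ g = rot4).
Proof.
move=> tp AM; have p5 : (4 < size quartic60)%N by rewrite size_quartic60.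
have p3 : (2 < size quartic60)%N by rewrite size_quartic60.
have [z [pz rel nz]] := AutAbs_moebius tp p3 AM.
have := minpoly_algC_root tp; rewrite root_quartic60 => /eqP pt.
move: pz; rewrite root_quartic60 => /eqP pz.
(* the cofactor of p(t) comes from dividing by p(t) as a polynomial in t *)
have : (z - t) * (z * (t + 1) + t + 2) * ((z - 2 + t ^+ 2) * (z * (t ^+ 2 - 3) + t ^+ 2 - 4)) = 0.
  have -> : (z - t) * (z * (t + 1) + t + 2) * ((z - 2 + t ^+ 2) * (z * (t ^+ 2 - 3) + t ^+ 2 - 4)) =
    (t + 1) * (t ^+ 2 - 3) * (z ^+ 4 + z ^+ 3 - 4 * z ^+ 2 - 4 * z + 1)
    - ((t + 1) * (t ^+ 2 - 3) + (z - t) * (t ^+ 2 - z * t - z ^+ 2 * t - 4 + z ^+ 2)) *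
      (t ^+ 4 + t ^+ 3 - 4 * t ^+ 2 - 4 * t + 1) by ring.
  by rewrite pz pt; ring.
have ME := mx2E M; move: (M 0 0) (M 0 1) (M 1 0) (M 1 1) ME rel nz => s u r v -> rel nz.
have {}rel : (ratr r * t + ratr v) * z - (ratr s * t + ratr u) = 0 by rewrite rel subrr.
move/eqP; rewrite !mulf_eq0 => /orP [/orP []|/orP []] /eqP zE.
- have [|/eqP u0 /eqP sv /eqP r0 _] :=
    minpoly_cubic_relation (x := - u) (y := v - s) (w := r) (q := 0) tp p5.
    rewrite rmorphB rmorphN rmorph0 /=; have zt : z = t by apply/eqP; rewrite -subr_eq0 zE.
    by rewrite -[RHS]rel zt; ring.
  exists s, 1%:M; split; last by left.
  rewrite -mx2_1 mx2Z !mulr1 !mulr0; rewrite oppr_eq0 in u0; rewrite subr_eq0 in sv.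
  by rewrite (eqP u0) (eqP r0) (eqP sv).
- have [|e0 e1 e2 _] := minpoly_cubic_relation (x := 2 * v + u) (y := 2 * r + v + s + u)
    (w := r + s) (q := 0) tp p5.
    rewrite !rmorphD !rmorphM rmorph0 /= !rmorph_nat.
    transitivity ((ratr r * t + ratr v) * (z * (t + 1) + t + 2) -
      (t + 1) * ((ratr r * t + ratr v) * z - (ratr s * t + ratr u))); first by ring.
    by rewrite rel zE !mulr0 subrr.
  by exists s, rot4; split; [rewrite mx2Z; congr mx2; lra | right].
- have [|e0 e1 e2 e3] := minpoly_cubic_relation (x := 2 * v - u) (y := 2 * r - s)
    (w := - v) (q := - r) tp p5.
    rewrite !rmorphB !rmorphN !rmorphM /= !rmorph_nat.
    transitivity (- (ratr r * t + ratr v) * (z - 2 + t ^+ 2) +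
      ((ratr r * t + ratr v) * z - (ratr s * t + ratr u))); first by ring.
    by rewrite rel zE !mulr0 addr0.
  by exfalso; case: nz => /eqP; lra.
have [|e0 e1 e2 e3] := minpoly_cubic_relation (x := 4 * v + 3 * u) (y := 4 * r + 3 * s)
    (w := - v - u) (q := - r - s) tp p5.
  rewrite !rmorphB !rmorphN !rmorphD !rmorphM /= !rmorph_nat.
  transitivity ((t ^+ 2 - 3) * ((ratr r * t + ratr v) * z - (ratr s * t + ratr u)) -
     (ratr r * t + ratr v) * (z * (t ^+ 2 - 3) + t ^+ 2 - 4)); first by ring.
  by rewrite rel zE !mulr0 subrr.
by exfalso; case: nz => /eqP; lra.
Qed.

Lemma rot4_sq : rot4 *m rot4 = mx2 (-1) 0 0 (-1).
Proof. by rewrite mx2M; congr mx2. Qed.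

Lemma scale_N1 (g : 'M[rat]_2) : -1 *: g = mx2 (-1) 0 0 (-1) *m g.
Proof. by rewrite mx2_N1 mulNmx mul1mx scaleN1r. Qed.

Lemma quartic60_AutAbs (t : algC) : minpoly_algC t quartic60 ->
  Aut (homogenization quartic60) = AutAbs (homogenization quartic60) /\
  AutAbs (homogenization quartic60) = generated [set rot4].
Proof.
move=> tp; have p3 : (2 < size quartic60)%N by rewrite size_quartic60.
have genA : generated [set rot4] `<=` Aut (homogenization quartic60).
  by apply: (generated_min (Aut_subgroup tp p3)) => _ ->; apply: quartic60_rot4.
have Agen : AutAbs (homogenization quartic60) `<=` generated [set rot4].
  move=> M AM; have [s [g [ME gP]]] := quartic60_AutAbs_scale tp AM.
  have gG : generated [set rot4] g.
    by case: gP => ->; [apply: generated1 | apply: sub_generated].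
  rewrite ME in AM *; have [[] -> _] := AutAbs_scale quartic60_monic p3 (genA _ gG) AM.
    by rewrite scale1r.
  rewrite scale_N1 -rot4_sq; apply: generatedM gG.
  by apply: generatedM; apply: sub_generated.
split; apply/seteqP; split => M.
- exact: Aut_AutAbs.
- by move=> /Agen /genA.
- exact: Agen.
- by move=> /genA /Aut_AutAbs.
Qed.

Lemma rot4_conjugate_C4 : conjugate (generated [set rot4]) C4.
Proof.
pose P := mx2 1 (-1) 0 1; pose Q := mx2 1 1 0 1.
have PQ : P *m Q = 1%:M by rewrite mx2M -mx2_1; congr mx2.
have [uP _] := mulmx1_unit PQ.
have PV : invmx P = Q by rewrite -[LHS]mulmx1 -PQ mulKmx.
have PE : P *m mx2 0 1 (-1) 0 *m invmx P = rot4 by rewrite PV !mx2M; congr mx2.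
apply: (conjugate_generated uP) => [_ ->|_ ->].
  by rewrite PE; apply: sub_generated.
by exists (mx2 0 1 (-1) 0); [apply: sub_generated | rewrite PE].
Qed.

(** The four roots are t, - t, 1/t and - 1/t. *)
Lemma quartic24_AutAbs_scale (t : algC) (M : 'M[rat]_2) :
    minpoly_algC t quartic24 -> AutAbs (homogenization quartic24) M ->
  exists s g, M = s *: g /\
    [\/ g = 1%:M, g = mx2 (-1) 0 0 1, g = mx2 0 1 1 0 | g = mx2 0 1 (-1) 0].
Proof.
move=> tp AM; have p5 : (4 < size quartic24)%N by rewrite size_quartic24.
have p3 : (2 < size quartic24)%N by rewrite size_quartic24.
have [z [pz rel _]] := AutAbs_moebius tp p3 AM.
have := minpoly_algC_root tp; rewrite root_quartic24 => /eqP pt.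
move: pz; rewrite root_quartic24 => /eqP pz.
have : (z - t) * (z + t) * ((z * t - 1) * (z * t + 1)) = 0.
  have -> : (z - t) * (z + t) * ((z * t - 1) * (z * t + 1)) =
    t ^+ 2 * (z ^+ 4 - 4 * z ^+ 2 + 1) - z ^+ 2 * (t ^+ 4 - 4 * t ^+ 2 + 1) by ring.
  by rewrite pz pt; ring.
have ME := mx2E M; move: (M 0 0) (M 0 1) (M 1 0) (M 1 1) ME rel => s u r v -> rel.
have {}rel : (ratr r * t + ratr v) * z - (ratr s * t + ratr u) = 0 by rewrite rel subrr.
move/eqP; rewrite !mulf_eq0 => /orP [/orP []|/orP []] /eqP zE.
- have [|e0 e1 e2 _] := minpoly_cubic_relation (x := - u) (y := v - s) (w := r) (q := 0) tp p5.
    rewrite rmorphB rmorphN rmorph0 /=.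
    transitivity ((ratr r * t + ratr v) * z - (ratr s * t + ratr u)
      - (ratr r * t + ratr v) * (z - t)); first by ring.
    by rewrite rel zE mulr0 subrr.
  exists s, 1%:M; split; last by constructor 1.
  by rewrite -mx2_1 mx2Z; congr mx2; lra.
- have [|e0 e1 e2 _] := minpoly_cubic_relation (x := - u) (y := - v - s) (w := - r) (q := 0) tp p5.
    rewrite rmorphB !rmorphN rmorph0 /=.
    transitivity ((ratr r * t + ratr v) * z - (ratr s * t + ratr u)
      - (ratr r * t + ratr v) * (z + t)); first by ring.
    by rewrite rel zE mulr0 subrr.
  exists v, (mx2 (-1) 0 0 1); split; last by constructor 2.
  by rewrite mx2Z; congr mx2; lra.
- have [|e0 e1 e2 _] := minpoly_cubic_relation (x := v) (y := r - u) (w := - s) (q := 0) tp p5.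
    rewrite rmorphB !rmorphN rmorph0 /=.
    transitivity (t * ((ratr r * t + ratr v) * z - (ratr s * t + ratr u))
      - (ratr r * t + ratr v) * (z * t - 1)); first by ring.
    by rewrite rel zE !mulr0 subrr.
  exists u, (mx2 0 1 1 0); split; last by constructor 3.
  by rewrite mx2Z; congr mx2; lra.
have [|e0 e1 e2 _] := minpoly_cubic_relation (x := - v) (y := - r - u) (w := - s) (q := 0) tp p5.
  rewrite rmorphB !rmorphN rmorph0 /=.
  transitivity (t * ((ratr r * t + ratr v) * z - (ratr s * t + ratr u))
    - (ratr r * t + ratr v) * (z * t + 1)); first by ring.
  by rewrite rel zE !mulr0 subrr.
exists u, (mx2 0 1 (-1) 0); split; last by constructor 4.
by rewrite mx2Z; congr mx2; lra.
Qed.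

Lemma quartic24_AutAbs (t : algC) : minpoly_algC t quartic24 ->
  Aut (homogenization quartic24) = AutAbs (homogenization quartic24) /\
  AutAbs (homogenization quartic24) = D4.
Proof.
move=> tp; have p3 : (2 < size quartic24)%N by rewrite size_quartic24.
have genA : D4 `<=` Aut (homogenization quartic24).
  apply: (generated_min (Aut_subgroup tp p3)) => _ [] ->; first exact: quartic24_swap.
  exact: quartic24_quarter_turn.
have swapG : D4 (mx2 0 1 1 0) by apply: sub_generated; left.
have turnG : D4 (mx2 0 1 (-1) 0) by apply: sub_generated; right.
have N1G : D4 (mx2 (-1) 0 0 (-1)).
  have -> : mx2 (-1) 0 0 (-1) = mx2 0 1 (-1) 0 *m mx2 0 1 (-1) 0.
    by rewrite mx2M; congr mx2.
  exact: generatedM.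
have reflG : D4 (mx2 (-1) 0 0 1).
  have -> : mx2 (-1) 0 0 1 = mx2 0 1 1 0 *m mx2 0 1 (-1) 0 by rewrite mx2M; congr mx2.
  exact: generatedM.
have Agen : AutAbs (homogenization quartic24) `<=` D4.
  move=> M AM; have [s [g [ME gP]]] := quartic24_AutAbs_scale tp AM.
  have gG : D4 g by case: gP => -> //; apply: generated1.
  rewrite ME in AM *; have [[] -> _] := AutAbs_scale quartic24_monic p3 (genA _ gG) AM.
    by rewrite scale1r.
  by rewrite scale_N1; apply: generatedM.
split; apply/seteqP; split => M.
- exact: Aut_AutAbs.
- by move=> /Agen /genA.
- exact: Agen.
- by move=> /genA /Aut_AutAbs.
Qed.

(** * Automorphisms in the generic cases *)

(** The even and the odd part of p vanish at t, and the one of lower degree than p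
    is therefore 0; it is the odd part, because p has a constant term. *)
Lemma minpoly_even (t : algC) (p : {poly rat}) :
    minpoly_algC t p -> (2 < size p)%N -> root (map_poly ratr p) (- t) ->
  ~~ odd (size p).-1 /\ forall i, p`_i != 0 -> ~~ odd i.
Proof.
move=> tp p3 /rootP pNt; have /rootP pt := minpoly_algC_root tp.
have [pm pP] := tp; have p0 : p != 0 by rewrite monic_neq0.
pose part (b : bool) : {poly rat} := \poly_(i < size p) (if odd i == b then p`_i else 0).
have part_root (b : bool) : root (map_poly ratr (part b)) t.
  apply/rootP; rewrite (@horner_coef_wide _ (size p)); last first.
    by rewrite size_map_poly size_poly.
  have two0 : 2 != 0 :> algC by rewrite pnatr_eq0.
  apply: (mulfI two0); rewrite mulr0.
  transitivity ((map_poly ratr p).[t] + (-1) ^+ b * (map_poly ratr p).[- t]); last first.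
    by rewrite pt pNt mulr0 addr0.
  rewrite !horner_coef size_map_poly !mulr_sumr -big_split; apply: eq_bigr => i _ /=.
  rewrite !coef_map coef_poly ltn_ord [(- t) ^+ _]exprNn -[(-1) ^+ i]signr_odd.
  by case: (odd i); case: b; rewrite /= ?rmorph0 ?expr0 ?expr1; ring.
have part0 (b : bool) : odd (size p).-1 != b -> part b = 0.
  move=> Db; apply/eqP; apply: contraT => part0.
  have := part_root b; rewrite pP => /(dvdp_leq part0); rewrite leqNgt; case/negP.
  rewrite -[size p]prednK ?ltnS; last by rewrite size_poly_gt0.
  apply/leq_sizeP => i i_ge; rewrite coef_poly; case: ltnP => // i_lt.
  have -> : i = (size p).-1 by lia.
  by rewrite (negbTE Db).
have p00 : p`_0 != 0.
  by have := minpoly_no_rational_root 0 tp p3; rewrite /root horner_coef0.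
have Deven : ~~ odd (size p).-1.
  apply/negP => Dodd; have := part0 false; rewrite Dodd => /(_ isT).
  move/(congr1 (fun q : {poly rat} => q`_0)); rewrite coef0 coef_poly /= (leq_trans _ p3) //.
  by apply/eqP.
split=> // i; apply: contra => oi; have := part0 true; rewrite (negbTE Deven) => /(_ isT).
move/(congr1 (fun q : {poly rat} => q`_i)); rewrite coef0 coef_poly oi /=.
by case: ltnP => [_ ->|i_ge _]; rewrite ?eqxx // nth_default.
Qed.

(** Diagonalize the swap. *)
Lemma D2_conjugate : conjugate (generated [set mx2 (-1) 0 0 1; mx2 1 0 0 (-1)]) D2.
Proof.
pose P := mx2 1 1 1 (-1); pose Q := mx2 (1 / 2) (1 / 2) (1 / 2) (- (1 / 2)).
have PQ : P *m Q = 1%:M by rewrite mx2M -mx2_1; congr mx2.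
have [uP _] := mulmx1_unit PQ.
have PV : invmx P = Q by rewrite -[LHS]mulmx1 -PQ mulKmx.
pose swap := mx2 0 1 1 0; pose neg := mx2 (-1) 0 0 (-1).
have swapE : P *m swap *m invmx P = mx2 1 0 0 (-1) by rewrite PV !mx2M; congr mx2.
have negE : P *m neg *m invmx P = mx2 (-1) 0 0 1 *m mx2 1 0 0 (-1).
  by rewrite PV !mx2M; congr mx2.
have prodE : P *m (neg *m swap) *m invmx P = mx2 (-1) 0 0 1.
  by rewrite PV !mx2M; congr mx2.
apply: (conjugate_generated uP) => [_ [] ->|_ [] ->].
- by rewrite swapE; apply: sub_generated; right.
- by rewrite negE; apply: generatedM; apply: sub_generated; [left | right].
- exists (neg *m swap); last by rewrite prodE.
  by apply: generatedM; apply: sub_generated; [right | left].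
by exists swap; [apply: sub_generated; left | rewrite swapE].
Qed.

(** The Moebius relations leave diagonal matrices, whose entries are read off at
    the points (1, 0) and (0, 1). Conversely - t is conjugate to t, so the form is
    even in each variable. *)
Lemma Aut_four (N : nat) (w : algC) (p : {poly rat}) :
    (2 < N)%N -> (4 %| N)%N -> N \notin [:: 4; 8; 12; 24]%N ->
    N.-primitive_root w -> minpoly_algC (cosz w 1) p -> (2 < size p)%N ->
  Aut (homogenization p) = generated [set mx2 (-1) 0 0 1; mx2 1 0 0 (-1)].
Proof.
move=> N2 N4 N_notin wN tp p3; have [pm _] := tp.
have [_ p_roots] := cosz_minpoly N2 wN tp.
have [jN wj] := prim_root_opp N4 wN.
have neg_root : root (map_poly ratr p) (- cosz w 1).
  have := cosz_conj_root wN jN (minpoly_algC_root tp).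
  by rewrite wj cosz_opp_odd.
have [Deven p_even] := minpoly_even tp p3 neg_root.
have D0 : (0 < (size p).-1)%N by lia.
have p00 : p`_0 != 0.
  by have := minpoly_no_rational_root 0 tp p3; rewrite /root horner_coef0.
apply/seteqP; split=> M; last first.
  move=> GM; apply: (generated_min (Aut_subgroup tp p3) _ GM) => _ [] -> /=.
    rewrite /Aut /=; apply: subst_hom_diag; rewrite !mxE //= => i i_lt /p_even ei.
    by rewrite -signr_odd (negbTE ei) expr1n mulr1.
  rewrite /Aut /=; apply: subst_hom_diag; rewrite !mxE //= => i i_lt /p_even ei.
  by rewrite -signr_odd oddB 1?(negbTE Deven) ?(negbTE ei) ?expr1n ?mulr1 //; lia.
move=> AM; have [z [/p_roots [k kN ->] rel nz]] := AutAbs_moebius tp p3 (Aut_AutAbs AM).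
have [M10 M01] := four_moebius (k := k) N4 N_notin wN kN rel.
have s1 : M 0 0 ^+ (size p).-1 = 1.
  have := Aut_eval (1 : algC) 0 AM.
  rewrite M10 !rmorph0 !mul0r !mulr0 !addr0 mulr1 !hom_eval0 // expr1n -rmorphXn /=.
  by move=> sD; apply: (fmorph_inj (ratr : {rmorphism rat -> algC})); rewrite /= sD rmorph1.
have v0 : M 1 1 != 0 by case: nz => //; rewrite M10 eqxx.
have v1 : M 1 1 ^+ (size p).-1 = 1.
  have := Aut_eval (0 : algC) 1 AM.
  rewrite M01 !rmorph0 !mulr0 !mul0r !add0r mulr1 hom_evalE ?ratr_eq0 // mul0r hom_eval1.
  rewrite horner_coef0 coef_map /= -{2}[ratr p`_0]mul1r -rmorphXn /=.
  move/(mulIf _); rewrite ratr_eq0 => /(_ p00) vD.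
  by apply: (fmorph_inj (ratr : {rmorphism rat -> algC})); rewrite /= vD rmorph1.
rewrite (mx2E M) M10 M01.
have [->|->] := rat_unity_root D0 (or_introl s1);
have [->|->] := rat_unity_root D0 (or_introl v1).
- by rewrite mx2_1; apply: generated1.
- by apply: sub_generated; right.
- by apply: sub_generated; left.
have -> : mx2 (-1) 0 0 (-1) = mx2 (-1) 0 0 1 *m mx2 1 0 0 (-1) by rewrite mx2M; congr mx2.
by apply: generatedM; apply: sub_generated; [left | right].
Qed.

Lemma prim_root_double (m : nat) (w : algC) : odd m ->
  (2 * m).-primitive_root w -> m.-primitive_root (- w).
Proof.
move=> om wN; have m0 : (0 < m)%N by case: (m) om.
have wm := prim_root_half wN.
have -> : - w = (w ^+ 2) ^+ (m./2.+1).
  rewrite -exprM (_ : 2 * m./2.+1 = m + 1)%N; first by rewrite exprD wm expr1 mulN1r.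
  by have := odd_double_half m; rewrite om; lia.
rewrite prim_root_exp_coprime.
  have e : (m./2.+1 * 2 = m + 1)%N by have := odd_double_half m; rewrite om; lia.
  have : coprime (m./2.+1 * 2) m by rewrite e coprime_sym /coprime gcdnDl gcdn1.
  by apply: coprime_dvdl; apply: dvdn_mulr.
by have := dvdn_prim_root wN (dvdn_mull 2 (dvdnn m)); rewrite mulnK.
Qed.

(** For N = 2 m the order is made odd by passing from w to - w, which negates the
    roots. *)
Lemma AutAbs_odd (m N : nat) (w : algC) (p : {poly rat}) (M : 'M[rat]_2) :
    odd m -> m \notin [:: 1; 3; 5; 7; 9; 15]%N -> N = m \/ N = (2 * m)%N ->
    N.-primitive_root w -> minpoly_algC (cosz w 1) p -> (2 < size p)%N ->
    AutAbs (homogenization p) M ->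
  M = M 0 0 *: 1%:M.
Proof.
move=> om m_notin Nm wN tp p3 AM.
have N2 : (2 < N)%N.
  by case: m om m_notin Nm => [|[|[|m]]] // _ _; lia.
have [_ p_roots] := cosz_minpoly N2 wN tp.
have [z [/p_roots [k kN ->] rel nz]] := AutAbs_moebius tp p3 AM.
suff [M10 M01 M00] : [/\ M 1 0 = 0, M 0 1 = 0 & M 0 0 = M 1 1].
  by rewrite {1}(mx2E M) -mx2_1 mx2Z M10 M01 -M00 mulr1 mulr0.
case: Nm => NE; subst N.
  exact: (odd_moebius (k := k) om m_notin wN kN rel nz).
have w'm := prim_root_double om wN.
have ok : odd k by rewrite -coprimen2; apply: coprime_dvdr kN; apply: dvdn_mulr.
have km : coprime k m by apply: coprime_dvdr kN; apply: dvdn_mull.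
have [||M10 M01 M00] := odd_moebius (c := M 1 0) (d := - M 1 1) (a := - M 0 0) (b := M 0 1)
  (k := k) om m_notin w'm km.
- rewrite !cosz_opp_odd // !rmorphN /=.
  have -> : (ratr (M 1 0) * - cosz w 1 - ratr (M 1 1)) * - cosz w k =
    (ratr (M 1 0) * cosz w 1 + ratr (M 1 1)) * cosz w k by ring.
  by rewrite rel; ring.
- by rewrite oppr_eq0.
by split=> //; apply: oppr_inj.
Qed.

(** * Conclusion *)

Lemma AutAbs_scalar (p : {poly rat}) : p \is monic -> (2 < size p)%N ->
    (forall M, AutAbs (homogenization p) M -> M = M 0 0 *: 1%:M) ->
  AutAbs (homogenization p) = [set 1%:M; - 1%:M] /\
  Aut (homogenization p) = if odd (size p).-1 then [set 1%:M] else [set 1%:M; - 1%:M].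
Proof.
move=> pm p3 scal; have F0 := homogenization_neq0 pm.
have subN1 : subst_form (homogenization p) (- 1%:M) =
    (-1) ^+ (size p).-1 *: homogenization p.
  by rewrite -scaleN1r subst_hom_scale subst_form1.
have N1A : AutAbs (homogenization p) (- 1%:M).
  rewrite /AutAbs /= subN1 -signr_odd; case: odd; first by right; rewrite scaleN1r.
  by left; rewrite scale1r.
have AutE : AutAbs (homogenization p) = [set 1%:M; - 1%:M].
  apply/seteqP; split=> M; last by case=> -> //; left; apply: subst_form1.
  move=> AM; have ME := scal M AM; move: AM; rewrite ME; move: (M 0 0) => s AM.
  have [[] -> _] := AutAbs_scale pm p3 (subst_form1 _) AM.
    by left; rewrite scale1r.
  by right; rewrite scaleN1r.
split=> //; apply/seteqP; split=> M.
  move=> AM; have := Aut_AutAbs AM; rewrite AutE => -[] ME; first by rewrite ME; case: odd; [|left].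
  case: ifP => Dodd; last by right.
  move: AM; rewrite /Aut /= ME subN1 -signr_odd Dodd expr1 scaleN1r => /eqP.
  rewrite eq_sym -addr_eq0 -mulr2n -scaler_nat scaler_eq0 (negbTE F0).
  by rewrite pnatr_eq0.
case: ifP => Dodd; first by move=> ->; apply: subst_form1.
case=> ->; first exact: subst_form1.
by rewrite /Aut /= subN1 -signr_odd Dodd expr0 scale1r.
Qed.

(** All that the description of the automorphisms uses about sines. *)
Lemma sin_minpoly_data (R : realType) (n : nat) :
    (4 < n)%N -> (3 <= sin_degree n)%N ->
  exists w : algC, [/\ (sin_order n).-primitive_root w, (2 < sin_order n)%N,
    minpoly_algC (cosz w 1) (sin_minpoly R n) &
    size (sin_minpoly R n) = (sin_degree n).+1].
Proof.
move=> n4 d3; have tE := totient_sin_order n4.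
have N2 : (2 < sin_order n)%N by rewrite -totient_gt1 tE; lia.
have [w wN] := C_prim_root_exists (ltnW (ltnW N2)); exists w.
have tp := sin_minpolyP R n4 wN; split=> //.
have [pE _] := cosz_minpoly N2 wN tp; have [pm _] := tp.
have p0 : (0 < size (sin_minpoly R n))%N by rewrite size_poly_gt0 monic_neq0.
by move: pE; rewrite tE; lia.
Qed.

Lemma minpoly_algC_eq (t : algC) (p q : {poly rat}) :
    minpoly_algC t p -> q \is monic -> size q = size p -> root (map_poly ratr q) t ->
  p = q.
Proof.
case=> pm pP qm qp; rewrite pP => pq; apply/eqP; rewrite -(eqp_monic pm qm).
by rewrite -dvdp_size_eqp // qp.
Qed.

(** In the four lemmas that follow, the value of the polynomial at w + 1/w is, up
    to a power of w, Phi_N(w), a factor of w^N - 1 or of w^(N/2) + 1. *)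
Lemma root_cubic_14 (w : algC) : 14.-primitive_root w ->
  root (map_poly ratr (cubic 1)) (cosz w 1).
Proof.
move=> wN; have w0 := prim_root_neq0 wN; have w7 := prim_root_half (m := 7) wN.
have w1 : w + 1 != 0.
  apply/eqP => w1; have : w ^+ 2 == 1.
    by rewrite (_ : w = -1) ?sqrrN ?expr1n //; apply/eqP; rewrite -addr_eq0 w1.
  by rewrite -(prim_order_dvd wN).
rewrite root_cubic rmorph1 /cosz expr1z exprN1.
have c0 : w ^+ 3 * (w + 1) != 0 by rewrite mulf_neq0 // expf_neq0.
apply/eqP/(mulfI c0); rewrite mulr0.
transitivity (w ^+ 7 + 1); first by field.
by rewrite w7 addNr.
Qed.

Lemma root_cubic_9 (w : algC) : 9.-primitive_root w ->
  root (map_poly ratr (cubic 0)) (cosz w 1).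
Proof.
move=> wN; have w0 := prim_root_neq0 wN.
have w3 : w ^+ 3 - 1 != 0 by rewrite subr_eq0 -(prim_order_dvd wN).
rewrite root_cubic rmorph0 /cosz expr1z exprN1.
have c0 : w ^+ 3 * (w ^+ 3 - 1) != 0 by rewrite mulf_neq0 // expf_neq0.
apply/eqP/(mulfI c0); rewrite mulr0.
transitivity (w ^+ 9 - 1); first by field.
by rewrite (prim_expr_order wN) subrr.
Qed.

Lemma root_quartic60_30 (w : algC) : 30.-primitive_root w ->
  root (map_poly ratr quartic60) (cosz w 1).
Proof.
move=> wN; have w0 := prim_root_neq0 wN; have w15 := prim_root_half (m := 15) wN.
have w5 : w ^+ 5 + 1 != 0.
  apply/eqP => w5; have : w ^+ 10 == 1.
    rewrite (exprM w 5 2) (_ : w ^+ 5 = -1) ?sqrrN ?expr1n //.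
    by apply/eqP; rewrite -addr_eq0 w5.
  by rewrite -(prim_order_dvd wN).
have w2 : w ^+ 2 - w + 1 != 0.
  apply/eqP => w2; have : w ^+ 6 == 1.
    have -> : w ^+ 6 = (w ^+ 2 - w + 1) * (w + 1) * (w ^+ 3 - 1) + 1 by ring.
    by rewrite w2 !mul0r add0r.
  by rewrite -(prim_order_dvd wN).
rewrite root_quartic60 /cosz expr1z exprN1.
have c0 : w ^+ 4 * (w ^+ 2 - w + 1) * (w ^+ 5 + 1) != 0.
  by rewrite !mulf_neq0 // expf_neq0.
apply/eqP/(mulfI c0); rewrite mulr0.
transitivity (w ^+ 15 + 1); first by field.
by rewrite w15 addNr.
Qed.

Lemma root_quartic24_24 (w : algC) : 24.-primitive_root w ->
  root (map_poly ratr quartic24) (cosz w 1).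
Proof.
move=> wN; have w0 := prim_root_neq0 wN; have w12 := prim_root_half (m := 12) wN.
have w4 : w ^+ 4 + 1 != 0.
  apply/eqP => w4; have : w ^+ 8 == 1.
    rewrite (exprM w 4 2) (_ : w ^+ 4 = -1) ?sqrrN ?expr1n //.
    by apply/eqP; rewrite -addr_eq0 w4.
  by rewrite -(prim_order_dvd wN).
rewrite root_quartic24 /cosz expr1z exprN1.
have c0 : w ^+ 4 * (w ^+ 4 + 1) != 0 by rewrite mulf_neq0 // expf_neq0.
apply/eqP/(mulfI c0); rewrite mulr0.
transitivity (w ^+ 12 + 1); first by field.
by rewrite w12 addNr.
Qed.

Theorem corollary1p2 (R : realType) (n : nat) (n_gt0 : (0 < n)%N)
    (n_notin : n \notin [:: 1; 2; 3; 4; 6; 8; 12; 20]%N) :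
  let d := sin_degree n in
  let F := sin_form R n in
  [/\
      size (sin_minpoly R n) = d.+1 /\ (3 <= d)%N,
      n = 4 %[mod 8] -> (5 <= d)%N -> odd d ->
        [/\ Aut F = [set 1%:M], isomorphic (Aut F) C1,
            AutAbs F = [set 1%:M; - 1%:M] & isomorphic (AutAbs F) C2],
      n = 4 %[mod 8] -> (6 <= d)%N -> ~~ odd d ->
        [/\ Aut F = AutAbs F, AutAbs F = [set 1%:M; - 1%:M] &
            isomorphic (AutAbs F) C2],
      n <> 4 %[mod 8] -> n <> 24%N ->
        Aut F = generated [set mx2 (-1) 0 0 1; mx2 1 0 0 (-1)] /\
        isomorphic (Aut F) D2 &
      [/\ n \in [:: 28; 36]%N ->
            [/\ Aut F = generated [set mx2 (-1) 1 (-1) 0],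
                conjugate (Aut F) C3,
                AutAbs F =
                  generated [set mx2 (-1) 1 (-1) 0; mx2 (-1) 0 0 (-1)] &
                conjugate (AutAbs F) C6],
          n = 60%N ->
            [/\ Aut F = AutAbs F,
                AutAbs F = generated [set mx2 1 2 (-1) (-1)] &
                conjugate (AutAbs F) C4] &
          n = 24%N ->
            [/\ Aut F = AutAbs F,
                AutAbs F = generated [set mx2 0 1 1 0; mx2 0 1 (-1) 0] &
                AutAbs F = D4]]].
Proof.
have [n4 d3] := sin_degree_ge3 n_gt0 n_notin.
have [w [wN N2 tp pS]] := sin_minpoly_data R n4 d3; have [pm _] := tp.
have p3 : (2 < size (sin_minpoly R n))%N by rewrite pS; lia.
move=> d F.
have scalar : n = 4 %[mod 8] -> (5 <= d)%N ->
    AutAbs F = [set 1%:M; - 1%:M] /\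
    Aut F = if odd d then [set 1%:M] else [set 1%:M; - 1%:M].
  move=> n8 d5; have [m om [nE NE]] := sin_order_four n4 n8.
  have m_notin : m \notin [:: 1; 3; 5; 7; 9; 15]%N.
    apply/negP; rewrite !inE => m_in; move: d5; rewrite /d nE leqNgt; case/negP.
    by move: m_in => /or4P [||| /or3P []] /eqP ->; vm_compute.
  have := AutAbs_scalar pm p3; rewrite pS; apply=> M.
  exact: (AutAbs_odd om m_notin NE wN tp p3).
split.
- by [].
- move=> n8 d5 dodd; have [AE] := scalar n8 d5; rewrite dodd => ->; rewrite AE.
  by split=> //; exact: isomorphic_refl.
- move=> n8 d6 deven; have [AE] := scalar n8 (ltnW d6); rewrite (negbTE deven) => ->.
  by rewrite AE; split=> //; exact: isomorphic_refl.
- move=> n8 n24; have [|N4 N_notin] := sin_order_other n4 n8.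
    rewrite !inE; move: n_notin; rewrite !inE; lia.
  rewrite /F /sin_form (Aut_four N2 N4 N_notin wN tp p3); split=> //.
  exact/conjugate_isomorphic/D2_conjugate.
have eq_minpoly q : q \is monic -> size q = d.+1 -> root (map_poly ratr q) (cosz w 1) ->
    sin_minpoly R n = q.
  by move=> qm qs; apply: (minpoly_algC_eq tp qm); rewrite pS.
split.
- move=> n_in; have [a pE] : exists a, sin_minpoly R n = cubic a.
    move: n_in; rewrite !inE => /orP [] /eqP nE; [exists 1 | exists 0];
      apply: eq_minpoly (cubic_monic _) _ _; rewrite ?size_cubic /d ?nE //.
    + by apply: root_cubic_14; move: wN; rewrite nE.
    + by apply: root_cubic_9; move: wN; rewrite nE.
  rewrite pE in tp; rewrite /F /sin_form pE (cubic_Aut tp) (cubic_AutAbs tp).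
  by split=> //; [apply: rot3_conjugate_C3 | apply: rot3_conjugate_C6].
- move=> nE; have pE : sin_minpoly R n = quartic60.
    apply: eq_minpoly quartic60_monic _ _; rewrite ?size_quartic60 /d ?nE //.
    by apply: root_quartic60_30; move: wN; rewrite nE.
  rewrite pE in tp; rewrite /F /sin_form pE; have [-> ->] := quartic60_AutAbs tp.
  by split=> //; apply: rot4_conjugate_C4.
move=> nE; have pE : sin_minpoly R n = quartic24.
  apply: eq_minpoly quartic24_monic _ _; rewrite ?size_quartic24 /d ?nE //.
  by apply: root_quartic24_24; move: wN; rewrite nE.
by rewrite pE in tp; rewrite /F /sin_form pE; have [-> ->] := quartic24_AutAbs tp.
Qed.
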